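(* For every prime $p\equiv 1 \pmod{4}$, there exists an integer $y(p)$ such that \[c\left(pn + \frac{p-1}{2}\right) + p^8\,c\left(\frac{n-(p-1)/2}{p}\right) = y(p)\,c(n)\] for all $n \in \mathbb{N}$.
   Context: Here $\mathbb{N}=\{0,1,2,\dots\}$. The integers $c(n)$, $n\ge 0$, are defined by \[\sum_{n=0}^\infty c(n)q^n := E_4(2z)\prod_{n=1}^\infty(1-q^n)^8(1-q^{2n})^2,\qquad q=e^{2\pi i z},\] where $E_4$ is the weight 4 Eisenstein series $E_4(z)=1-\frac{8}{B_4}\sum_{n=1}^\infty \sigma_3(n)q^n = 1+240\sum_{n=1}^\infty\sigma_3(n)q^n$, with $B_4=-1/30$ the fourth Bernoulli number and $\sigma_3(n)=\sum_{d\mid n}d^3$; thus $E_4(2z)=1+240\sum_{n\ge1}\sigma_3(n)q^{2n}$. By convention, $c(x)=0$ whenever $x$ is not a nonnegative integer. *)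

(* Defs.v *)
From HB Require Import structures.
From mathcomp Require Import all_boot all_order all_algebra.
From mathcomp Require Import ring.

Set Implicit Arguments.
Unset Strict Implicit.
Unset Printing Implicit Defensive.

Import Order.TTheory GRing.Theory Num.Theory.
Local Open Scope ring_scope.

(* A formal power series in q with integer coefficients is represented by its
   coefficient function [nat -> int]. *)

Definition series_mul (f g : nat -> int) (n : nat) : int :=
  \sum_(i < n.+1) f i * g (n - i)%N.

Definition sigma3 (n : nat) : nat := (\sum_(d <- divisors n) d ^ 3)%N.

Definition E4 (n : nat) : int :=
  if n == 0%N then 1 else 240 * (sigma3 n)%:Z.

(* q |-> q^2, i.e. z |-> 2z *)
Definition series_double (f : nat -> int) (n : nat) : int :=
  if (2 %| n)%N then f (n %/ 2)%N else 0.

Definition etaprod_factor (k : nat) : {poly int} :=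
  (1 - 'X^k) ^+ 8 * (1 - 'X^(2 * k)) ^+ 2.

Definition etaprod_partial (N : nat) : {poly int} :=
  \prod_(1 <= k < N.+1) etaprod_factor k.

(* The infinite product is the q-adic limit of its partial products: the
   coefficient of q^n no longer changes from the n-th partial product on
   (see [etaprod_stable]). *)
Definition etaprod (n : nat) : int := (etaprod_partial n)`_n.

Lemma etaprod_factorE k :
  exists r : {poly int}, etaprod_factor k = 1 + r * 'X^k.
Proof.
have E (u : {poly int}) m : exists r, (1 - u) ^+ m = 1 + r * u.
  elim: m => [|m [r Hr]]; first by exists 0; rewrite expr0 mul0r addr0.
  by exists (r - 1 - r * u); rewrite exprSr Hr; ring.
have [r Hr] := E 'X^k 8%N; have [s Hs] := E 'X^(2 * k) 2%N.
exists (r + s * 'X^k + r * 'X^k * s * 'X^k).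
by rewrite /etaprod_factor Hr Hs mul2n -addnn exprD; ring.
Qed.

Lemma etaprod_stable n N :
  (n <= N)%N -> (etaprod_partial N)`_n = etaprod n.
Proof.
elim: N => [|N IHN]; first by rewrite leqn0 => /eqP->.
rewrite leq_eqVlt => /orP[/eqP-> // | lt_nN].
have [r Hr] := etaprod_factorE N.+1.
rewrite /etaprod_partial big_nat_recr //= Hr mulrDr mulr1 mulrA.
by rewrite coefD coefMXn lt_nN addr0 IHN.
Qed.

Definition c_nat : nat -> int := series_mul (series_double E4) etaprod.

(* c(x) = 0 unless x is a nonnegative integer *)
Definition c (x : rat) : int :=
  if x \is a Num.nat then c_nat (Num.truncn x) else 0.

Lemma c_natE n : c n%:R = c_nat n.
Proof. by rewrite /c natr_nat natrK. Qed.

(* Main.v *)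
(* The series F = sum c(n) x^(2n+1) comes from the Hamilton quaternions: 3 F is a sum of
   P(z) x^N(z) over the Lipschitz quaternions z congruent to 1 or to i + j + k modulo
   2 (1 + i), where P is harmonic of degree 7.  For a prime p = 1 mod 4, let X_p be the set
   of quaternions y of norm p congruent to 1.  It is stable under signed permutations of
   the coordinates along i, j, k, and averaging over these shows that P is an eigenvector
   of P |-> sum P(z y) over y in X_p.  On the other hand z = x y with y in X_p has at most
   one solution if z is not divisible by p, and #X_p solutions otherwise; since Jacobi's
   four square theorem counts both sides, at most one means exactly one.  Hence
   a(p m) + p^8 a(m / p) = a(p) a(m) for the coefficients a(m) of F.

   The expression of F by quaternions is an identity between theta functions and their
   derivatives.  Changing the lattice basis to (u - v, u + v) relates theta functions at x
   and at x^2, and a series Y with u Y = w Y(x^2) vanishes as soon as its first coefficients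
   do; in this way the logarithmic derivatives of theta_2, theta_3, theta_4 are seen to
   satisfy the Halphen system, which reduces every identity to algebra.  The infinite
   product enters by Gauss' identity, and E4 by Ramanujan's E2^2 - 12 D E2 = E4, which is
   Liouville's elementary evaluation of the convolution of sigma with itself. *)
Require Import Defs.
From HB Require Import structures.
From mathcomp Require Import all_boot all_order all_algebra.
From mathcomp Require Import boolp.
From mathcomp Require Import zify ring lra.

Set Implicit Arguments.
Unset Strict Implicit.
Unset Printing Implicit Defensive.

Import Order.TTheory GRing.Theory Num.Theory.
Local Open Scope ring_scope.

(** * Power series with integer coefficients *)

(** Wrapped in a record so that the Cauchy product can be the multiplication of a ring of its own,
    apart from bare functions. *)
Record fps := Fps { coef_fps :> nat -> int }.

HB.instance Definition _ := gen_eqMixin fps.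
HB.instance Definition _ := gen_choiceMixin fps.

Lemma fpsP (f g : fps) : f =1 g -> f = g.
Proof. by case: f g => f [g] /= /funext ->. Qed.

Definition trunc_fps (N : nat) (f : fps) : {poly int} := \poly_(i < N.+1) f i.

(** Ring laws for series are inherited from polynomials: for every [N], both sides agree up to x^N
    with one and the same polynomial. *)
Definition agree (N : nat) (p : {poly int}) (f : fps) :=
  forall n, (n <= N)%N -> p`_n = f n.

Lemma agree_trunc N f : agree N (trunc_fps N f) f.
Proof. by move=> n le_nN; rewrite coef_poly ltnS le_nN. Qed.
Arguments agree_trunc : clear implicits.

Definition fps_add (f g : fps) := Fps (fun n => f n + g n).
Definition fps_opp (f : fps) := Fps (fun n => - f n).
Definition fps_mul (f g : fps) := Fps (series_mul f g).
Definition fps_poly (p : {poly int}) := Fps (fun n => p`_n).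

Lemma agree_mul N p q f g :
  agree N p f -> agree N q g -> agree N (p * q) (fps_mul f g).
Proof.
move=> Hp Hq n le_nN; rewrite coefM; apply: eq_bigr => i _.
have le_in : (i <= n)%N by rewrite -ltnS.
by rewrite Hp ?Hq // (leq_trans _ le_nN) ?leq_subr.
Qed.

Lemma agree_inj f g : (forall N, exists2 p, agree N p f & agree N p g) -> f = g.
Proof. by move=> H; apply/fpsP => n; have [p <- // <-] := H n. Qed.

Fact fps_addA : associative fps_add.
Proof. by move=> f g h; apply/fpsP => n /=; rewrite addrA. Qed.
Fact fps_addC : commutative fps_add.
Proof. by move=> f g; apply/fpsP => n /=; rewrite addrC. Qed.
Fact fps_add0 : left_id (fps_poly 0) fps_add.
Proof. by move=> f; apply/fpsP => n /=; rewrite coef0 add0r. Qed.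
Fact fps_addN : left_inverse (fps_poly 0) fps_opp fps_add.
Proof. by move=> f; apply/fpsP => n /=; rewrite coef0 addNr. Qed.

HB.instance Definition _ :=
  GRing.isZmodule.Build fps fps_addA fps_addC fps_add0 fps_addN.

Fact fps_mulA : associative fps_mul.
Proof.
move=> f g h; apply: agree_inj => N.
have [Hf Hg Hh] := And3 (agree_trunc N f) (agree_trunc N g) (agree_trunc N h).
exists (trunc_fps N f * trunc_fps N g * trunc_fps N h); last by do 2 apply: agree_mul => //.
by rewrite -mulrA; do 2 apply: agree_mul => //.
Qed.
Fact fps_mulC : commutative fps_mul.
Proof.
move=> f g; apply: agree_inj => N.
have [Hf Hg] := conj (agree_trunc N f) (agree_trunc N g).
exists (trunc_fps N f * trunc_fps N g); first exact: agree_mul.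
by rewrite mulrC; apply: agree_mul.
Qed.
Fact agree_poly N p : agree N p (fps_poly p).
Proof. by []. Qed.
Arguments agree_poly : clear implicits.
Fact fps_mul1 : left_id (fps_poly 1) fps_mul.
Proof.
move=> f; apply: agree_inj => N; exists (trunc_fps N f); last exact: agree_trunc.
by rewrite -[trunc_fps N f]mul1r; apply: agree_mul => //; apply: agree_trunc.
Qed.
Fact fps_mulDl : left_distributive fps_mul fps_add.
Proof.
move=> f g h; apply/fpsP => n /=; rewrite /series_mul -big_split /=.
by apply: eq_bigr => i _; rewrite mulrDl.
Qed.
Fact fps_1neq0 : fps_poly 1 != 0 :> fps.
Proof. by apply/eqP => /(congr1 (fun f : fps => f 0%N)) /=; rewrite coef1 coef0. Qed.

HB.instance Definition _ := GRing.Zmodule_isComNzRing.Build fps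
  fps_mulA fps_mulC fps_mul1 fps_mulDl fps_1neq0.

Lemma coef_fpsD f g n : (f + g : fps) n = f n + g n. Proof. by []. Qed.
Lemma coef_fpsN f n : (- f : fps) n = - f n. Proof. by []. Qed.
Lemma coef_fpsB f g n : (f - g : fps) n = f n - g n. Proof. by []. Qed.
Lemma coef_fps0 n : (0 : fps) n = 0. Proof. exact: coef0. Qed.
Lemma coef_fps1 n : (1 : fps) n = (n == 0%N)%:R. Proof. exact: coef1. Qed.
Lemma coef_fpsM f g n : (f * g : fps) n = \sum_(i < n.+1) f i * g (n - i)%N.
Proof. by []. Qed.
Lemma coef_fpsM0 f g : (f * g : fps) 0%N = f 0%N * g 0%N.
Proof. by rewrite coef_fpsM big_ord_recl big_ord0 addr0. Qed.
Lemma coef_fpsMn f k n : (f *+ k : fps) n = f n *+ k.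
Proof. by elim: k => [|k IHk]; rewrite ?mulr0n ?coef_fps0 // !mulrS coef_fpsD IHk. Qed.
Lemma coef_fps_natM k f n : (k%:R * f : fps) n = k%:R * f n.
Proof. by rewrite !mulr_natl coef_fpsMn. Qed.
Lemma coef_fps_sum I (r : seq I) (P : pred I) (F : I -> fps) n :
  (\sum_(i <- r | P i) F i : fps) n = \sum_(i <- r | P i) F i n.
Proof. exact: (big_morph (fun f : fps => f n) (fun f g => coef_fpsD f g n) (coef_fps0 n)). Qed.

Lemma fps_poly_is_zmod : zmod_morphism fps_poly.
Proof. by move=> p q; apply/fpsP => n; rewrite coef_fpsB /= coefB. Qed.
Lemma fps_poly_is_monoid : monoid_morphism fps_poly.
Proof.
split=> // p q; apply: agree_inj => N; exists (p * q); first exact: agree_poly.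
by apply: agree_mul; apply: agree_poly.
Qed.
HB.instance Definition _ := GRing.isZmodMorphism.Build _ _ fps_poly fps_poly_is_zmod.
HB.instance Definition _ := GRing.isMonoidMorphism.Build _ _ fps_poly fps_poly_is_monoid.

Definition fpsX : fps := fps_poly 'X.

(* The substitution [x |-> x^2]. *)
Definition dbl (f : fps) : fps := Fps (series_double f).

Lemma agree_dbl N p f : agree N p f -> agree N (p \Po 'X^2) (dbl f).
Proof.
move=> Hp n le_nN; rewrite coef_comp_poly_Xn //= /series_double.
by case: ifP => // _; rewrite Hp // (leq_trans (leq_div _ _)).
Qed.

Lemma dbl_is_zmod : zmod_morphism dbl.
Proof.
by move=> f g; apply/fpsP => n; rewrite /= /series_double; case: ifP; rewrite ?subr0.
Qed.
Lemma dbl_is_monoid : monoid_morphism dbl.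
Proof.
split=> [|f g].
  apply: agree_inj => N; exists 1; last exact: agree_poly.
  have ->: 1 = 1 \Po 'X^2 :> {poly int} by rewrite -[1]/(1%:P) comp_polyC.
  by apply: agree_dbl; apply: agree_poly.
apply: agree_inj => N.
have [Hf Hg] := conj (agree_trunc N f) (agree_trunc N g).
exists ((trunc_fps N f * trunc_fps N g) \Po 'X^2); first exact/agree_dbl/agree_mul.
by rewrite comp_polyM; apply: agree_mul; apply: agree_dbl.
Qed.
HB.instance Definition _ := GRing.isZmodMorphism.Build _ _ dbl dbl_is_zmod.
HB.instance Definition _ := GRing.isMonoidMorphism.Build _ _ dbl dbl_is_monoid.

Lemma coef_dbl f n : dbl f n = if (2 %| n)%N then f (n %/ 2)%N else 0.
Proof. by []. Qed.
Lemma coef_dbl2 f n : dbl f n.*2 = f n.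
Proof. by rewrite coef_dbl -muln2 dvdn_mull // mulnK. Qed.
Lemma dbl_inj : injective dbl.
Proof. by move=> f g E; apply/fpsP => n; rewrite -(coef_dbl2 f) E coef_dbl2. Qed.

(* The derivation [x d/dx]. *)
Definition dif (f : fps) : fps := Fps (fun n => n%:R * f n).

Lemma coef_dif f n : dif f n = n%:R * f n. Proof. by []. Qed.
Lemma dif_is_zmod : zmod_morphism dif.
Proof. by move=> f g; apply/fpsP => n; rewrite /= mulrBr. Qed.
HB.instance Definition _ := GRing.isZmodMorphism.Build _ _ dif dif_is_zmod.

Lemma difM f g : dif (f * g) = dif f * g + f * dif g.
Proof.
apply/fpsP => n; rewrite coef_fpsD coef_dif !coef_fpsM mulr_sumr -big_split /=.
apply: eq_bigr => i _; have le_in : (i <= n)%N by rewrite -ltnS.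
by rewrite -{1}(subnKC le_in) natrD; ring.
Qed.
Lemma dif1 : dif 1 = 0.
Proof. by apply/fpsP => -[|n]; rewrite coef_dif coef_fps1 coef_fps0 ?mul0r ?mulr0. Qed.
Lemma difX f n : dif (f ^+ n.+1) = n.+1%:R * f ^+ n * dif f.
Proof.
elim: n => [|n IHn]; first by rewrite expr0 expr1 !mul1r.
by rewrite exprS difM IHn [n.+2%:R]mulrS exprS; ring.
Qed.
Lemma dif_nat k f : dif (k%:R * f) = k%:R * dif f.
Proof. by rewrite !mulr_natl raddfMn. Qed.
Lemma dif_dbl f : dif (dbl f) = 2%:R * dbl (dif f).
Proof.
apply/fpsP => n; rewrite coef_fps_natM coef_dif !coef_dbl coef_dif.
by case: ifP => [/divnK{1}<-|_]; rewrite ?mulr0 // natrM; ring.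
Qed.

(** * Orders of vanishing and uniqueness under x -> x^2 *)

Lemma fps_neq0P (f : fps) : f != 0 ->
  exists2 k, f k != 0 & forall i, (i < k)%N -> f i = 0.
Proof.
move=> nz_f; have ex_k : exists k, f k != 0.
  apply: contrapT => /forallNP fk0; case/eqP: nz_f; apply/fpsP => n.
  by rewrite coef_fps0; apply/eqP/negPn/negP/fk0.
exists (ex_minn ex_k); case: ex_minnP => // k _ min_k i lt_ik.
by apply/eqP; apply: contraTT lt_ik => /min_k; rewrite -leqNgt.
Qed.

Lemma coef_fpsM_low (f g : fps) k l :
  (forall i, (i < k)%N -> f i = 0) -> (forall i, (i < l)%N -> g i = 0) ->
  (f * g : fps) (k + l)%N = f k * g l.
Proof.
move=> f0 g0; have lt_k : (k < (k + l).+1)%N by rewrite ltnS leq_addr.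
rewrite coef_fpsM (bigD1 (Ordinal lt_k)) //= addKn big1 ?addr0 // => i ne_ik.
have [lt_ik|lt_ki|eq_ik] := ltngtP i k; first by rewrite f0 ?mul0r.
  by rewrite g0 ?mulr0 //; have := ltn_ord i; lia.
by case/eqP: ne_ik; apply: val_inj.
Qed.

Lemma fps_mulf_eq0 (f g : fps) : f * g = 0 -> f != 0 -> g = 0.
Proof.
move=> fg0 /fps_neq0P[k nz_fk f0]; apply/eqP/negPn/negP => /fps_neq0P[l nz_gl g0].
have := coef_fpsM_low f0 g0; rewrite fg0 coef_fps0 => /esym/eqP.
by rewrite mulf_eq0 (negPf nz_fk) (negPf nz_gl).
Qed.

Lemma fps_mulf_neq0 (f g : fps) : f != 0 -> g != 0 -> f * g != 0.
Proof. by move=> nz_f; apply: contraNneq => /fps_mulf_eq0 ->. Qed.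

Lemma fps_mulfI (f : fps) : f != 0 -> injective ( *%R f).
Proof.
move=> nz_f g h E; apply/eqP; rewrite -subr_eq0; apply/eqP.
by apply: fps_mulf_eq0 nz_f; rewrite mulrBr E subrr.
Qed.

Lemma fps_neq0 (f : fps) n : f n != 0 -> f != 0.
Proof. by apply: contraNneq => ->; rewrite coef_fps0. Qed.

(* If [u] vanishes to order at most 1, then [u * Y] vanishes to order at most
   [1 + ord Y], whereas [dbl Y] vanishes to order exactly [2 * ord Y]. *)
Lemma fps_dbl_uniq (u w Y : fps) :
  u 0%N != 0 \/ u 1%N != 0 -> Y 0%N = 0 -> Y 1%N = 0 ->
  u * Y = w * dbl Y -> Y = 0.
Proof.
move=> u01 Y0 Y1 E; apply/eqP/negPn/negP => /fps_neq0P[l nz_Yl Yl0].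
have [k le_k1 [nz_uk uk0]] : exists2 k, (k <= 1)%N &
    u k != 0 /\ forall i, (i < k)%N -> u i = 0.
  have [u0|nz_u0] := eqVneq (u 0%N) 0; last by exists 0%N.
  exists 1%N => //; case: u01; rewrite ?u0 ?eqxx // => ->; split=> //.
  by case.
have l_gt1: (1 < l)%N by case: l nz_Yl {Yl0} => [|[|]] //; rewrite ?Y0 ?Y1.
have := coef_fpsM_low uk0 Yl0; rewrite E coef_fpsM big1 => [/esym/eqP|i _].
  by rewrite mulf_eq0 (negPf nz_uk) (negPf nz_Yl).
(* The halved index lies below [l], because [k <= 1 < l] gives [k + l < 2 * l]. *)
rewrite coef_dbl; case: ifP => [_|]; rewrite ?mulr0 // Yl0 ?mulr0 //.
by rewrite ltn_divLR //; have := ltn_ord i; lia.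
Qed.

(** * Inverses and logarithmic derivatives *)

Lemma fps_expr_low (h : fps) n :
  h 0%N = 0 -> forall i, (i < n)%N -> (h ^+ n : fps) i = 0.
Proof.
move=> h0; elim: n => // n IHn i lt_i; rewrite exprS coef_fpsM big1 // => j _.
have [->|j_gt0] := posnP j; first by rewrite h0 mul0r.
by rewrite IHn ?mulr0 //; have := ltn_ord j; lia.
Qed.

(** The geometric series in [1 - f], cut off at exponent [n]; it inverts [f] when the constant term
    is 1, since higher powers of [1 - f] then do not reach x^n. *)
Definition fps_inv (f : fps) : fps :=
  Fps (fun n => (\sum_(k < n.+1) (1 - f) ^+ k : fps) n).

Lemma fps_mulfV (f : fps) : f 0%N = 1 -> f * fps_inv f = 1.
Proof.
move=> f0; pose h := 1 - f.
have h0 : h 0%N = 0 by rewrite coef_fpsB coef_fps1 f0 subrr.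
have hX n := @fps_expr_low h n h0.
pose S n := \sum_(k < n.+1) h ^+ k.
have fS n : f * S n = 1 - h ^+ n.+1.
  by rewrite /S -[f](subKr 1) -/h -opprB mulNr -subrX1 opprB.
have SE n i : (i <= n)%N -> S n i = S i i.
  move/subnK <-; elim: (n - i)%N => // m IHm; rewrite addSn -IHm /S big_ord_recr.
  by rewrite coef_fpsD hX ?addr0 //= ltnS leq_addl.
apply/fpsP => n; have -> : (f * fps_inv f : fps) n = (f * S n : fps) n.
  by rewrite !coef_fpsM; apply: eq_bigr => i _; rewrite SE ?leq_subr.
by rewrite fS coef_fpsB hX ?subr0.
Qed.

Definition logdif (f : fps) : fps := dif f * fps_inv f.

Lemma logdifE (f : fps) : f 0%N = 1 -> dif f = logdif f * f.
Proof. by move=> f0; rewrite -mulrA [_ * f]mulrC fps_mulfV ?mulr1. Qed.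

Lemma coef_fpsM1 (f g : fps) :
  (f * g : fps) 1%N = f 0%N * g 1%N + f 1%N * g 0%N.
Proof. by rewrite coef_fpsM !big_ord_recl big_ord0 addr0. Qed.

(** * Generating series of lattice sums *)

(** [f n] lists the finitely many points of norm [n], so that a sum over an infinite lattice becomes
    an honest power series. *)
Definition fibered (T : eqType) (N : T -> nat) (f : nat -> seq T) :=
  forall n, uniq (f n) /\ forall x, (x \in f n) = (N x == n).

Definition gs (T : eqType) (f : nat -> seq T) (w : T -> int) : fps :=
  Fps (fun n => \sum_(x <- f n) w x).

Definition pairfib (S T : eqType) (f : nat -> seq S) (g : nat -> seq T) (n : nat) :
    seq (S * T) :=
  flatten [seq [seq (x, y) | x <- f i, y <- g (n - i)%N] | i <- iota 0 n.+1].

Lemma coef_gs (T : eqType) (f : nat -> seq T) w n :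
  gs f w n = \sum_(x <- f n) w x.
Proof. by []. Qed.

Lemma pairfib_fibered (S T : eqType) (N : S -> nat) (M : T -> nat) f g :
  fibered N f -> fibered M g ->
  fibered (fun z : S * T => (N z.1 + M z.2)%N) (pairfib f g).
Proof.
move=> Hf Hg n; split.
  rewrite /pairfib; set F := fun i => _; elim: (iota 0 n.+1) (iota_uniq 0 n.+1) => //= i s IHs.
  case/andP=> nsi us; rewrite cat_uniq IHs // andbT; apply/andP; split.
    by apply: allpairs_uniq; [case: (Hf i)|case: (Hg (n - i)%N)|case=> ? ? [? ?]].
  apply/hasPn => -[x y] /flattenP[_ /mapP[j sj ->]] /allpairsP[[x' y'] /= [fx _ [-> _]]].
  apply/negP => /allpairsP[[x2 y2] /= [fx2 _ [E _]]].
  move: fx fx2; rewrite -E (proj2 (Hf _)) => /eqP Ej; rewrite (proj2 (Hf _)) => /eqP Ei.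
  by move: sj nsi; rewrite -Ei Ej => ->.
case=> x y /=; apply/flattenP/eqP.
  move=> [_ /mapP[i + ->] /allpairsP[[x' y'] /= [fx gy [-> ->]]]].
  rewrite mem_iota => /andP[_ le_in].
  move: fx gy; rewrite (proj2 (Hf _)) (proj2 (Hg _)) => /eqP -> /eqP ->; lia.
move=> E; exists [seq (x0, y0) | x0 <- f (N x), y0 <- g (n - N x)%N].
  by apply/mapP; exists (N x) => //; rewrite mem_iota; lia.
apply/allpairsP; exists (x, y); split=> //=; first by rewrite (proj2 (Hf _)).
by rewrite (proj2 (Hg _)) -E addKn.
Qed.

Lemma gsM (S T : eqType) (f : nat -> seq S) (g : nat -> seq T) v w :
  gs f v * gs g w = gs (pairfib f g) (fun z => v z.1 * w z.2).
Proof.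
apply/fpsP => n; rewrite coef_fpsM coef_gs /pairfib big_flatten big_map.
rewrite -[iota 0 n.+1]/(index_iota 0 n.+1) big_mkord; apply: eq_bigr => i _.
by rewrite big_allpairs !coef_gs big_distrlr.
Qed.

Lemma eq_gs (T : eqType) (f : nat -> seq T) v w : v =1 w -> gs f v = gs f w.
Proof. by move=> E; apply/fpsP => n; apply: eq_bigr => x _. Qed.

Lemma gsD (T : eqType) (f : nat -> seq T) v w :
  gs f v + gs f w = gs f (fun x => v x + w x).
Proof. by apply/fpsP => n; rewrite coef_fpsD !coef_gs -big_split. Qed.

Lemma gsN (T : eqType) (f : nat -> seq T) v : - gs f v = gs f (fun x => - v x).
Proof. by apply/fpsP => n; rewrite coef_fpsN !coef_gs sumrN. Qed.

Lemma gsZ (T : eqType) (f : nat -> seq T) v k :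
  k%:R * gs f v = gs f (fun x => k%:R * v x).
Proof. by apply/fpsP => n; rewrite coef_fps_natM !coef_gs mulr_sumr. Qed.

Lemma dif_gs (T : eqType) (N : T -> nat) f w : fibered N f ->
  dif (gs f w) = gs f (fun x => (N x)%:R * w x).
Proof.
move=> Hf; apply/fpsP => n; rewrite coef_dif !coef_gs mulr_sumr !big_seq.
by apply: eq_bigr => x; rewrite (proj2 (Hf n)) => /eqP ->.
Qed.

Lemma sum_bij (S T : eqType) (s : seq S) (t : seq T) (h : S -> T) (g : T -> S)
    (F : T -> int) :
  uniq s -> uniq t -> (forall x, x \in s -> h x \in t) ->
  (forall y, y \in t -> g y \in s) -> (forall x, x \in s -> g (h x) = x) ->
  (forall y, y \in t -> h (g y) = y) ->
  \sum_(y <- t) F y = \sum_(x <- s) F (h x).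
Proof.
move=> us ut hs gt hK gK; rewrite -(big_map h xpredT F); apply: perm_big.
apply: uniq_perm => // [|y].
  by rewrite map_inj_in_uniq // => x x' sx sx' E; rewrite -(hK x) // E hK.
apply/idP/mapP => [ty|[x sx ->]]; last exact: hs.
by exists (g y); rewrite ?gt ?gK.
Qed.

Lemma gs_reindex (T : eqType) (N : T -> nat) f (h g : T -> T) w :
  fibered N f -> cancel h g -> cancel g h -> (forall x, N (h x) = N x) ->
  gs f (fun x => w (h x)) = gs f w.
Proof.
move=> Hf hK gK Nh; apply/fpsP => n; rewrite !coef_gs; have [uf mf] := Hf n.
apply/esym; apply: (sum_bij (g := g)) => // x; rewrite !mf ?Nh //.
by rewrite -(Nh (g x)) gK.
Qed.

(** * Squares, sums of squares and change of lattice basis *)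

Definition nsq (a : int) : nat := (`|a| ^ 2)%N.

Lemma nsqE a : (nsq a)%:Z = a ^+ 2.
Proof. by rewrite /nsq; lia. Qed.

Lemma nsq_rot u v : (nsq (u - v) + nsq (u + v))%N = (2 * (nsq u + nsq v))%N.
Proof.
have E : ((nsq (u - v) + nsq (u + v))%:Z = (2 * (nsq u + nsq v))%:Z).
  by rewrite PoszM !PoszD !nsqE; ring.
by case: E.
Qed.

(** Candidates from -n to n are enough, because |a| <= a^2. *)
Definition zfib (n : nat) : seq int :=
  [seq a <- [seq k%:Z - n%:Z | k <- iota 0 (2 * n).+1] | nsq a == n].

Lemma zfib_fibered : fibered nsq zfib.
Proof.
move=> n; split=> [|a].
  by rewrite filter_uniq // map_inj_uniq ?iota_uniq // => i j /addIr [].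
rewrite mem_filter andb_idr // => /eqP E; apply/mapP.
have le_an: (`|a| <= n)%N by rewrite -E /nsq; nia.
by exists (absz (a + n%:Z)); [rewrite mem_iota; lia|lia].
Qed.

Definition fib2 := pairfib zfib zfib.
Definition fib4 := pairfib fib2 fib2.

Definition nsq2 (z : int * int) : nat := (nsq z.1 + nsq z.2)%N.
Definition nsq4 (z : (int * int) * (int * int)) : nat := (nsq2 z.1 + nsq2 z.2)%N.

Lemma fib2_fibered : fibered nsq2 fib2.
Proof. exact: pairfib_fibered zfib_fibered zfib_fibered. Qed.
Lemma fib4_fibered : fibered nsq4 fib4.
Proof. exact: pairfib_fibered fib2_fibered fib2_fibered. Qed.

Definition th (w : int -> int) : fps := gs zfib w.

(** As residues are natural numbers below 4, weights can be table lookups and identities between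
    them finite checks. *)
Definition res4 (a : int) : nat := `|(a %% 4)%Z|%N.

Lemma res4_lt a : (res4 a < 4)%N.
Proof. by rewrite /res4; lia. Qed.
Lemma odd_nsq a : odd (nsq a) = odd (res4 a).
Proof. by rewrite /nsq oddX /res4 /=; lia. Qed.
Lemma res4D a b : res4 (a + b) = ((res4 a + res4 b) %% 4)%N.
Proof. by rewrite /res4; lia. Qed.
Lemma res4N a : res4 (- a) = ((4 - res4 a) %% 4)%N.
Proof. by rewrite /res4; lia. Qed.
Lemma res4M a b : res4 (a * b) = ((res4 a * res4 b) %% 4)%N.
Proof. by rewrite /res4 -modzMm; nia. Qed.

(* The weights of the Jacobi theta functions: with [x^4] as nome, [th3] and [th4] are
   theta_3 and theta_4, while [th2 = sum x^(a^2)] over odd [a] is theta_2. *)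
Definition w3 (a : int) : int := [:: 1; 0; 1; 0]`_(res4 a).
Definition w4 (a : int) : int := [:: 1; 0; -1; 0]`_(res4 a).
Definition w2 (a : int) : int := [:: 0; 1; 0; 1]`_(res4 a).
Definition chi (a : int) : int := [:: 0; 1; 0; -1]`_(res4 a).

Definition th2 := th w2.
Definition th3 := th w3.
Definition th4 := th w4.
(** With nome x^4 this is Jacobi's theta_1'(0), normalised to equal theta_2 theta_3 theta_4. *)
Definition thA := th (fun a => chi a * a).

Lemma thM v w : th v * th w = gs fib2 (fun z => v z.1 * w z.2).
Proof. exact: gsM. Qed.

(** Pairs of entries congruent modulo 2 are exactly the images of (u, v) under (u - v, u + v), a map
    that doubles the norm. The duplication formulas below all come from this. *)
Lemma gs2_rot (w : int * int -> int) :
  (forall z, odd (res4 z.1 + res4 z.2) -> w z = 0) ->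
  gs fib2 w = dbl (gs fib2 (fun z => w (z.1 - z.2, z.1 + z.2))).
Proof.
move=> w0; apply/fpsP => n; rewrite coef_dbl; have [un mn] := fib2_fibered n.
case: ifP => n2; last first.
  rewrite coef_gs big_seq big1 // => -[a b]; rewrite mn /nsq2 /= => /eqP E.
  by apply: w0; rewrite /= oddD -!odd_nsq -oddD E; lia.
rewrite !coef_gs; have [um mm] := fib2_fibered (n %/ 2)%N.
rewrite (bigID (fun z => odd (res4 z.1 + res4 z.2))) /= big1 ?add0r => [|z]; last exact: w0.
rewrite -big_filter.
apply: (sum_bij (g := fun z => (((z.1 + z.2) %/ 2)%Z, ((z.2 - z.1) %/ 2)%Z))) => //.
- exact: filter_uniq.
- move=> [u v]; rewrite mm mem_filter mn /nsq2 /= nsq_rot => /eqP E.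
  apply/andP; split; first by rewrite /res4; lia.
  by apply/eqP; lia.
- move=> [a b]; rewrite mm mem_filter mn /nsq2 /= => /andP[ab /eqP E].
  have [k Ek] : exists k, b = a + 2 * k by exists ((b - a) %/ 2)%Z; move: ab; rewrite /res4; lia.
  have -> : ((a + b) %/ 2)%Z = a + k by lia.
  have -> : ((b - a) %/ 2)%Z = k by lia.
  apply/eqP; have := nsq_rot (a + k) k; have -> : a + k - k = a by lia.
  have -> : a + k + k = b by lia.
  by rewrite E; lia.
- by move=> [u v] _ /=; congr pair; lia.
- move=> [a b]; rewrite mem_filter /= => /andP[ab _].
  by congr pair; move: ab; rewrite /res4; lia.
Qed.

(** * Duplication formulas and the Halphen system *)

Lemma fib2_flip (w : int * int -> int) :
  gs fib2 (fun z => w (z.1, - z.2)) = gs fib2 w.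
Proof.
apply: (gs_reindex (g := fun z => (z.1, - z.2)) _ fib2_fibered).
- by case=> a b /=; rewrite opprK.
- by case=> a b /=; rewrite opprK.
- by case=> a b; rewrite /nsq2 /nsq /= abszN.
Qed.

Lemma fps_double_inj (f g : fps) : 2%:R * f = 2%:R * g -> f = g.
Proof.
move=> E; apply/fpsP => n.
by apply: (@mulfI _ 2%:R) => //; rewrite -!coef_fps_natM E.
Qed.

Ltac res4_cases u v :=
  have := res4_lt u; have := res4_lt v;
  case: (res4 u) => [|[|[|[|//]]]]; case: (res4 v) => [|[|[|[|//]]]] _ _;
  repeat match goal with |- context [modn ?m ?d] =>
    let r := eval vm_compute in (modn m d) in change (modn m d) with r end;
  rewrite /=.

Lemma th3_sq : th3 ^+ 2 = dbl (th3 ^+ 2 + th2 ^+ 2).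
Proof.
rewrite !expr2 !thM gsD gs2_rot => [|[u v] /=]; last first.
  by rewrite /w3; res4_cases u v.
congr dbl; apply: eq_gs => -[u v] /=.
by rewrite /w3 /w2 !res4D res4N; res4_cases u v.
Qed.

Lemma th4_sq : th4 ^+ 2 = dbl (th3 ^+ 2 - th2 ^+ 2).
Proof.
rewrite !expr2 !thM gsN gsD gs2_rot => [|[u v] /=]; last first.
  by rewrite /w4; res4_cases u v.
congr dbl; apply: eq_gs => -[u v] /=.
by rewrite /w4 /w3 /w2 !res4D res4N; res4_cases u v.
Qed.

Lemma th2_sq : th2 ^+ 2 = 2%:R * dbl (th3 * th2).
Proof.
rewrite mulr_natl mulr2n -raddfD /= {1}[th3 * th2]mulrC !expr2 !thM gsD.
rewrite gs2_rot => [|[u v] /=]; last by rewrite /w2; res4_cases u v.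
congr dbl; apply: eq_gs => -[u v] /=.
by rewrite /w3 /w2 !res4D res4N; res4_cases u v.
Qed.

Lemma th3_th4 : th3 * th4 = dbl (th4 ^+ 2).
Proof.
rewrite expr2 !thM gs2_rot => [|[u v] /=]; last first.
  by rewrite /w3 /w4; res4_cases u v.
(* Pairs with both entries odd cancel against their images under [v |-> - v]; hence the doubling,
   which averages over this reflection. *)
congr dbl; apply: fps_double_inj; rewrite !mulr_natl mulr2n.
rewrite -{2}fib2_flip -mulr_natl gsZ gsD /=; apply: eq_gs => -[u v] /=.
by rewrite /w3 /w4 !(res4D, res4N); res4_cases u v.
Qed.

Lemma thA_th2 : thA * th2 = 2%:R * dbl (thA * th4).
Proof.
rewrite mulr_natl mulr2n -raddfD /= {1}[thA * th4]mulrC !thM gsD.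
rewrite gs2_rot => [|[u v] /=]; last by rewrite /chi /w2; res4_cases u v; rewrite ?mul0r ?mulr0.
congr dbl; apply: fps_double_inj; rewrite !mulr_natl mulr2n.
rewrite -{2}fib2_flip -mulr_natl gsZ gsD /=; apply: eq_gs => -[u v] /=.
rewrite /chi /w4 /w2 !(res4D, res4N); res4_cases u v; lia.
Qed.

Lemma th3_0 : th3 0%N = 1. Proof. by rewrite coef_gs unlock. Qed.
Lemma th4_0 : th4 0%N = 1. Proof. by rewrite coef_gs unlock. Qed.
Lemma th2_0 : th2 0%N = 0. Proof. by rewrite coef_gs unlock. Qed.
Lemma th2_1 : th2 1%N = 2. Proof. by rewrite coef_gs unlock. Qed.
Lemma th3_1 : th3 1%N = 0. Proof. by rewrite coef_gs unlock. Qed.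
Lemma th4_1 : th4 1%N = 0. Proof. by rewrite coef_gs unlock. Qed.
Lemma thA_0 : thA 0%N = 0. Proof. by rewrite coef_gs unlock. Qed.
Lemma thA_1 : thA 1%N = 2. Proof. by rewrite coef_gs unlock. Qed.

Ltac dblE := rewrite ?(rmorphXn, rmorph_nat, rmorphD, rmorphB, rmorphM, rmorphN) /=.

(** The square of [th3_th4] and the product of [th3_sq] with [th4_sq] give two expressions for
    [th3 ^+ 2 * th4 ^+ 2], both in the image of the injective [dbl]. *)
Lemma th_quartic : th3 ^+ 4 = th2 ^+ 4 + th4 ^+ 4.
Proof.
have E : th3 ^+ 2 * th4 ^+ 2 = dbl th4 ^+ 4.
  by rewrite -exprMn th3_th4 -!rmorphXn -exprM.
move: E; rewrite th3_sq th4_sq; dblE => E; apply: dbl_inj; dblE.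
by rewrite -E; ring.
Qed.

(** Jacobi's derivative formula: both sides solve [th2 * Y = 2%:R * dbl th4 * dbl Y] and start with
    2 x. *)
Lemma thA_prod : thA = th2 * th3 * th4.
Proof.
apply/eqP; rewrite -subr_eq0; apply/eqP.
apply: (@fps_dbl_uniq th2 (2%:R * dbl th4)).
- by right; rewrite th2_1.
- by rewrite coef_fpsB !coef_fpsM0 thA_0 th2_0 !mul0r.
- by rewrite coef_fpsB !(coef_fpsM1, coef_fpsM0) thA_1 th2_0 th2_1 th3_0 th3_1 th4_0 th4_1.
rewrite mulrBr [th2 * thA]mulrC thA_th2.
have -> : th2 * (th2 * th3 * th4) = th2 ^+ 2 * (th3 * th4) by ring.
by rewrite th2_sq th3_th4; dblE; ring.
Qed.

Lemma th2_neq0 : th2 != 0.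
Proof. by apply: (@fps_neq0 _ 1); rewrite th2_1. Qed.
Lemma th3_neq0 : th3 != 0.
Proof. by apply: (@fps_neq0 _ 0); rewrite th3_0. Qed.
Lemma th4_neq0 : th4 != 0.
Proof. by apply: (@fps_neq0 _ 0); rewrite th4_0. Qed.

Lemma dif_th2_sq : th2 * dif th2 = 2%:R * dbl (dif th3 * th2 + th3 * dif th2).
Proof.
apply: fps_double_inj; have := congr1 dif th2_sq; rewrite difX expr1 dif_nat dif_dbl difM.
by move=> E; rewrite mulrA E.
Qed.
Lemma dif_th3_sq : th3 * dif th3 = 2%:R * dbl (th3 * dif th3 + th2 * dif th2).
Proof.
apply: fps_double_inj; have := congr1 dif th3_sq.
rewrite dif_dbl raddfD /= !difX !expr1 -!mulrA => ->.
by dblE; ring.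
Qed.
Lemma dif_th4_sq : th4 * dif th4 = 2%:R * dbl (th3 * dif th3 - th2 * dif th2).
Proof.
apply: fps_double_inj; have := congr1 dif th4_sq.
rewrite dif_dbl raddfB /= !difX !expr1 -!mulrA => ->.
by dblE; ring.
Qed.

(** * Logarithmic derivatives of the theta series *)

Definition L3 := logdif th3.
Definition L4 := logdif th4.
(** [logdif] needs constant term 1, which [th2] lacks; [dif_th2] shows that this is nevertheless its
    logarithmic derivative. *)
Definition L2 := L3 + th4 ^+ 4.

Lemma dif_th3 : dif th3 = L3 * th3.
Proof. exact: logdifE th3_0. Qed.
Lemma dif_th4 : dif th4 = L4 * th4.
Proof. exact: logdifE th4_0. Qed.

(** The difference [Y] of the two sides satisfies [th2 * th3 * Y = 2%:R * th4 ^+ 2 * dbl Y], and its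
    first two coefficients vanish. *)
Lemma wronskian_th2_th3 : dif th2 * th3 - th2 * dif th3 = th2 * th3 * th4 ^+ 4.
Proof.
apply/eqP; rewrite -subr_eq0; apply/eqP.
apply: (@fps_dbl_uniq (th2 * th3) (2%:R * th4 ^+ 2)).
- by right; rewrite coef_fpsM1 th2_0 th2_1 th3_0 th3_1.
- by rewrite !(coef_fpsB, coef_fpsM0, coef_dif) th2_0 !mul0r.
- rewrite [th4 ^+ 4]exprS -[th4 ^+ 3]/(th4 * (th4 * th4)).
  by rewrite !(coef_fpsB, coef_fpsM1, coef_fpsM0, coef_dif) th2_0 th2_1 th3_0 th3_1 th4_0 th4_1.
have th24 : dbl (th4 ^+ 4) = (dbl th3 ^+ 2 + dbl th2 ^+ 2) * th4 ^+ 2.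
  rewrite th4_sq; have /(congr1 dbl) := th_quartic; dblE => E.
  have -> : dbl th4 ^+ 4 = dbl th3 ^+ 4 - dbl th2 ^+ 4 by rewrite E; ring.
  by ring.
have -> : th2 * th3 * (dif th2 * th3 - th2 * dif th3 - th2 * th3 * th4 ^+ 4) =
   (th2 * dif th2) * th3 ^+ 2 - th2 ^+ 2 * (th3 * dif th3)
      - th2 ^+ 2 * th3 ^+ 2 * (th4 ^+ 2 * th4 ^+ 2) by ring.
rewrite dif_th2_sq dif_th3_sq th2_sq th3_sq rmorphB (rmorphM _ (th2 * th3)) /= th24.
have E : th4 ^+ 2 = dbl th3 ^+ 2 - dbl th2 ^+ 2 by rewrite th4_sq; dblE.
by rewrite E; dblE; ring.
Qed.

Lemma dif_th2 : dif th2 = L2 * th2.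
Proof.
apply: (fps_mulfI th3_neq0); have := wronskian_th2_th3.
rewrite dif_th3 /L2 => /eqP; rewrite subr_eq => /eqP E.
by rewrite mulrC E; ring.
Qed.

Lemma L34 : L3 = L4 + th2 ^+ 4.
Proof.
have E : th3 ^+ 2 * th4 ^+ 2 * (2%:R * (L3 - L4 - th2 ^+ 4)) = 0.
  have -> : th3 ^+ 2 * th4 ^+ 2 * (2%:R * (L3 - L4 - th2 ^+ 4)) =
    2%:R * (th3 * (L3 * th3) * th4 ^+ 2 - th3 ^+ 2 * (th4 * (L4 * th4))
      - th3 ^+ 2 * th4 ^+ 2 * (th2 ^+ 2 * th2 ^+ 2)) by ring.
  have E : dbl (th4 ^+ 4) = th3 ^+ 2 * th4 ^+ 2.
    by rewrite -exprMn th3_th4 -rmorphXn -exprM.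
  rewrite -E -dif_th3 -dif_th4 dif_th3_sq dif_th4_sq dif_th3 dif_th2 th2_sq th3_sq th4_sq.
  have /(congr1 dbl) := th_quartic; rewrite /L2; dblE => E4.
  ring: E4.
move: E => /fps_mulf_eq0 E; apply/eqP; rewrite eq_sym -subr_eq0 -opprB oppr_eq0 opprD addrA.
apply/eqP/(@fps_mulfI 2%:R); rewrite ?mulr0 ?E //.
  by apply: (@fps_neq0 _ 0); rewrite -(mulr1 2%:R) coef_fps_natM coef_fps1.
by apply: (@fps_neq0 _ 0); rewrite !coef_fpsM0 th3_0 th4_0.
Qed.

Lemma th2_4 : th2 ^+ 4 = L3 - L4.
Proof. by rewrite L34; ring. Qed.
Lemma th4_4 : th4 ^+ 4 = L2 - L3.
Proof. by rewrite /L2; ring. Qed.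
Lemma th3_4 : th3 ^+ 4 = L2 - L4.
Proof. by rewrite th_quartic th2_4 th4_4; ring. Qed.

Lemma fps2_neq0 : (2%:R : fps) != 0.
Proof. by apply: (@fps_neq0 _ 0); rewrite -(mulr1 2%:R) coef_fps_natM coef_fps1. Qed.

Lemma L2_rec : L2 = dbl (L2 + L3).
Proof.
apply: (fps_mulfI (f := th2 ^+ 2)); first exact: fps_mulf_neq0 th2_neq0 th2_neq0.
have := dif_th2_sq; rewrite dif_th2 dif_th3 => E.
have -> : th2 ^+ 2 * L2 = th2 * (L2 * th2) by ring.
by rewrite E th2_sq; dblE; ring.
Qed.

Lemma L34_rec : L3 + L4 = 4%:R * dbl L4.
Proof.
apply: (fps_mulfI (f := th3 * th4)).
  by apply: (@fps_neq0 _ 0); rewrite !coef_fpsM0 th3_0 th4_0.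
have := congr1 dif th3_th4; rewrite difM dif_dbl difX dif_th3 dif_th4 => E.
have -> : th3 * th4 * (L3 + L4) = L3 * th3 * th4 + th3 * (L4 * th4) by ring.
by rewrite E th3_th4; dblE; ring.
Qed.

(** Obtained by multiplying the derivatives of [th3_sq] and [th4_sq]. Together with [L2_rec] and
    [L34_rec] it writes the defect in [dif_L2] as a series in x^2. *)
Lemma L3_mul_L4 : L3 * L4 = 4%:R * dbl (L4 * (L2 + L3) - L2 * L3).
Proof.
apply: (fps_mulfI (f := th3 ^+ 2 * th4 ^+ 2)).
  by apply: (@fps_neq0 _ 0); rewrite !coef_fpsM0 th3_0 th4_0.
have E : th3 ^+ 2 * th4 ^+ 2 = dbl (th4 ^+ 4).
  by rewrite -exprMn th3_th4 -rmorphXn -exprM.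
rewrite {2}E th4_4.
have -> : th3 ^+ 2 * th4 ^+ 2 * (L3 * L4) = th3 * dif th3 * (th4 * dif th4).
  by rewrite dif_th3 dif_th4; ring.
rewrite dif_th3_sq dif_th4_sq dif_th3 dif_th2.
have -> : 2%:R * dbl (th3 * (L3 * th3) + th2 * (L2 * th2)) *
     (2%:R * dbl (th3 * (L3 * th3) - th2 * (L2 * th2))) =
   4%:R * dbl (th3 ^+ 4 * L3 ^+ 2 - th2 ^+ 4 * L2 ^+ 2) by dblE; ring.
by rewrite th3_4 th2_4; dblE; ring.
Qed.

Lemma dif_L2_L3 : dif L2 - dif L3 = 4%:R * L4 * (L2 - L3).
Proof. by rewrite -raddfB /= -th4_4 difX dif_th4 /=; ring. Qed.

Lemma dif_L3_L4 : dif L3 - dif L4 = 4%:R * L2 * (L3 - L4).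
Proof. by rewrite -raddfB /= -th2_4 difX dif_th2 /=; ring. Qed.

(* The defect [H] of the equation satisfies [H = 4 * dbl H], hence vanishes. *)
Lemma dif_L2 : dif L2 = 2%:R * (L2 * L3 + L2 * L4 - L3 * L4).
Proof.
apply/eqP; rewrite -subr_eq0; apply/eqP; set H := LHS.
have E3 : dif L3 = dif L2 - 4%:R * L4 * (L2 - L3) by rewrite -dif_L2_L3; ring.
have HE : H = 4%:R * dbl H.
  have -> : 4%:R * dbl H = dbl (4%:R * H) by rewrite rmorphM rmorph_nat.
  have -> : 4%:R * H = 2%:R * (dif L2 + dif L3) - 8%:R * (L2 * L3) by rewrite E3 /H; ring.
  have -> : H = dif L2 - 2%:R * (L2 * (L3 + L4) - L3 * L4) by rewrite /H; ring.
  rewrite L3_mul_L4 L34_rec {1 2}L2_rec dif_dbl raddfD /=.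
  by dblE; ring.
apply: (@fps_dbl_uniq 1 4%:R); rewrite ?mul1r //.
- by left; rewrite coef_fps1.
- have : H 0%N = 4 * H 0%N by rewrite {1}HE coef_fps_natM.
  by move: (H 0%N) => x; lia.
- by rewrite HE coef_fps_natM coef_dbl /= mulr0.
Qed.

Lemma dif_L3 : dif L3 = 2%:R * (L3 * L2 + L3 * L4 - L2 * L4).
Proof.
have -> : dif L3 = dif L2 - 4%:R * L4 * (L2 - L3) by rewrite -dif_L2_L3; ring.
by rewrite dif_L2; ring.
Qed.

Lemma dif_L4 : dif L4 = 2%:R * (L4 * L2 + L4 * L3 - L2 * L3).
Proof.
have -> : dif L4 = dif L3 - 4%:R * L2 * (L3 - L4) by rewrite -dif_L3_L4; ring.
by rewrite dif_L3; ring.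
Qed.

Lemma dif_thA : dif thA = (L2 + L3 + L4) * thA.
Proof. by rewrite thA_prod !difM dif_th2 dif_th3 dif_th4; ring. Qed.

(** * The Euler product and Gauss' identity *)

(** Congruence modulo x^(N+1), under which an infinite product may be replaced by a partial one. *)
Definition eqm (N : nat) (f g : fps) := forall n, (n <= N)%N -> f n = g n.

Lemma eqmM N f f' g g' : eqm N f f' -> eqm N g g' -> eqm N (f * g) (f' * g').
Proof.
move=> Ef Eg n le_nN; rewrite !coef_fpsM; apply: eq_bigr => i _.
have le_in : (i <= n)%N by rewrite -ltnS.
by rewrite Ef ?Eg // (leq_trans _ le_nN) ?leq_subr.
Qed.

Lemma eqm_sym N f g : eqm N f g -> eqm N g f.
Proof. by move=> E n le_nN; rewrite E. Qed.
Lemma eqm_trans N f g h : eqm N f g -> eqm N g h -> eqm N f h.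
Proof. by move=> E1 E2 n le_nN; rewrite E1 ?E2. Qed.
Lemma eqmX N f g k : eqm N f g -> eqm N (f ^+ k) (g ^+ k).
Proof. by move=> E; elim: k => // k IHk; rewrite !exprS; apply: eqmM. Qed.
Lemma eqm_inj f g : (forall N, eqm N f g) -> f = g.
Proof. by move=> E; apply/fpsP => n; apply: (E n). Qed.
Lemma eqm_dbl N f g : eqm N f g -> eqm N (dbl f) (dbl g).
Proof.
move=> E n le_nN; rewrite !coef_dbl; case: ifP => // _.
by rewrite E // (leq_trans (leq_div _ _)).
Qed.

Lemma coef_fpsXn k n : (fpsX ^+ k : fps) n = (n == k)%:R.
Proof. by rewrite -rmorphXn /= coefXn. Qed.
Lemma coef_fpsXnM k (f : fps) n :
  (fpsX ^+ k * f : fps) n = if (n < k)%N then 0 else f (n - k)%N.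
Proof.
have [lt_nk|le_kn] := ltnP n k.
  rewrite coef_fpsM big1 // => i _; rewrite coef_fpsXn; case: eqP => [Ei|]; rewrite ?mul0r //.
  by have := ltn_ord i; lia.
have lt_k : (k < n.+1)%N by [].
rewrite coef_fpsM (bigD1 (Ordinal lt_k)) //= coef_fpsXn eqxx mul1r big1 ?addr0 // => i ne_ik.
by rewrite coef_fpsXn; case: eqP => [Ei|]; rewrite ?mul0r //; case/eqP: ne_ik; apply: val_inj.
Qed.
Lemma dbl_X : dbl fpsX = fpsX ^+ 2.
Proof.
apply/fpsP => n; rewrite coef_fpsXn coef_dbl /= coefX.
case: ifP => [/dvdnP[k ->]|n2]; last by case: eqP n2 => // ->.
by rewrite mulnK // (_ : (k * 2 == 2)%N = (k == 1)%N) //; lia.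
Qed.

Definition eulerp (N : nat) : {poly int} := \prod_(1 <= k < N.+1) (1 - 'X^k).
Definition euler : fps := Fps (fun n => (eulerp n)`_n).

Lemma eulerp_stable n N : (n <= N)%N -> (eulerp N)`_n = euler n.
Proof.
elim: N => [|N IHN]; first by rewrite leqn0 => /eqP->.
rewrite leq_eqVlt => /orP[/eqP-> // | lt_nN].
rewrite /eulerp big_nat_recr //= mulrBr mulr1 coefB coefMXn lt_nN subr0.
exact: IHN.
Qed.

Definition eulerN (N : nat) : fps := \prod_(1 <= k < N.+1) (1 - fpsX ^+ k).
Lemma eulerNS N : eulerN N.+1 = eulerN N * (1 - fpsX ^+ N.+1).
Proof. by rewrite /eulerN big_nat_recr. Qed.
Lemma eulerNE N : eulerN N = fps_poly (eulerp N).
Proof.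
rewrite rmorph_prod; apply: eq_bigr => k _.
by rewrite rmorphB rmorph1 rmorphXn.
Qed.
Lemma eqm_euler N : eqm N (eulerN N) euler.
Proof. by move=> n le_nN; rewrite eulerNE /= eulerp_stable. Qed.

Lemma etaprodE : Fps etaprod = euler ^+ 8 * dbl euler ^+ 2.
Proof.
apply: eqm_inj => N; apply: (@eqm_trans _ _ (fps_poly (etaprod_partial N))).
  by move=> n le_nN /=; rewrite etaprod_stable.
rewrite rmorph_prod /=.
have -> : \prod_(1 <= k < N.+1) fps_poly (etaprod_factor k) = eulerN N ^+ 8 * dbl (eulerN N) ^+ 2.
  rewrite /eulerN rmorph_prod -!prodrXl -big_split; apply: eq_bigr => k _ /=.
  by rewrite !(rmorphM, rmorphXn, rmorphB, rmorph1) /= dbl_X -exprM.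
by apply: eqmM; apply: eqmX; [|apply: eqm_dbl]; apply: eqm_euler.
Qed.

(** * Divisor sums and the logarithmic derivative of the Euler product *)

Definition sig (k n : nat) : nat := (\sum_(d <- divisors n) d ^ k)%N.
Definition Sg (k : nat) : fps := Fps (fun n => if n is 0%N then 0 else (sig k n)%:Z).

Lemma sigE k n N : (0 < n <= N)%N -> sig k n = (\sum_(1 <= d < N.+1 | d %| n) d ^ k)%N.
Proof.
move=> /andP[n_gt0 le_nN]; rewrite /sig -[RHS]big_filter; apply: perm_big.
apply: uniq_perm; rewrite ?divisors_uniq ?filter_uniq ?iota_uniq // => d.
rewrite -dvdn_divisors // mem_filter mem_index_iota; case: (boolP (d %| n)%N) => //= dv.
by rewrite (dvdn_gt0 n_gt0) // ltnS (leq_trans (dvdn_leq _ dv)).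
Qed.

(* [x d/dx] of [- ln (1 - x^k)]. *)
Definition lamb (k : nat) : fps := Fps (fun n => if (k %| n)%N && (0 < n)%N then k%:Z else 0).

Lemma lambE k : (0 < k)%N -> (1 - fpsX ^+ k) * lamb k = k%:R * fpsX ^+ k.
Proof.
move=> k_gt0; apply/fpsP => n; rewrite coef_fps_natM coef_fpsXn mulrBl mul1r.
rewrite coef_fpsB coef_fpsXnM /=; have [lt_nk|le_kn] := ltnP n k.
  have [->|n_gt0] := posnP n; first by rewrite andbF subr0 (ltn_eqF k_gt0) mulr0.
  by rewrite gtnNdvd //= ltn_eqF // mulr0.
rewrite (leq_trans k_gt0 le_kn) andbT -{1}(subnK le_kn) dvdn_addl // subn_gt0.
have [->|ne_nk] := eqVneq n k; first by rewrite ltnn andbF subnn dvdn0 subr0 mulr1 natz.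
by rewrite ltn_neqAle eq_sym ne_nk le_kn /= andbT subrr mulr0.
Qed.

Lemma dif_euler : dif euler = - (euler * Sg 1).
Proof.
have difN N : dif (eulerN N) = - (eulerN N * \sum_(1 <= k < N.+1) lamb k).
  elim: N => [|N IHN]; first by rewrite /eulerN !big_geq // dif1 mulr0 oppr0.
  rewrite eulerNS [in RHS]big_nat_recr //= difM IHN raddfB /= dif1.
  have -> : dif (fpsX ^+ N.+1) = N.+1%:R * fpsX ^+ N.+1.
    apply/fpsP => n; rewrite coef_fps_natM coef_dif coef_fpsXn.
    by case: eqP => [->|]; rewrite ?mulr0.
  by rewrite -lambE //; ring.
apply/fpsP => n; rewrite coef_dif -(@eqm_euler n n) // -coef_dif difN !coef_fpsN.
congr (- _); apply: (@eqmM n) => //; first exact: eqm_euler.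
move=> m le_mn; rewrite coef_fps_sum /=; have [->|m_gt0] := posnP m.
  by rewrite big1 // => k _; rewrite andbF.
rewrite -(prednK m_gt0) /= (prednK m_gt0) (@sigE _ _ n) ?m_gt0 // -natz natr_sum [in RHS]big_mkcond.
by apply: eq_bigr => k _; rewrite andbT natz expn1.
Qed.

(** * Gauss' identity *)

Definition inv1p (k : nat) : fps := fps_inv (1 + fpsX ^+ k).
Lemma inv1pE k : (0 < k)%N -> (1 + fpsX ^+ k) * inv1p k = 1.
Proof.
move=> k_gt0; apply: fps_mulfV; rewrite coef_fpsD coef_fps1 coef_fpsXn.
by rewrite (ltn_eqF k_gt0) addr0.
Qed.

(** The k-th factor (1 - x^k) / (1 + x^k) of Gauss' product for the sum of (-1)^a x^(a^2). *)
Definition rho (k : nat) : fps := (1 - fpsX ^+ k) * inv1p k.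
Definition rhoprod (s n : nat) : fps := \prod_(s.+1 <= k < n.+1) rho k.

(* Shanks' finite form of Gauss' identity: [shanks n] agrees with the product
   [rhoprod 0 n] up to [x^n], and equals the theta polynomial of [shanksE]. *)
Definition shanks (n : nat) : fps := rhoprod 0 n +
  \sum_(1 <= s < n.+1) 2%:R * (-1) ^+ s * rhoprod s n * fpsX ^+ (s * n.+1) * inv1p s.

Lemma rhoprodS s n : (s <= n)%N -> rhoprod s n.+1 = rhoprod s n * rho n.+1.
Proof. by move=> le_sn; rewrite /rhoprod big_nat_recr. Qed.

Lemma rhoprod_recl s n : (s < n)%N -> rhoprod s n = rho s.+1 * rhoprod s.+1 n.
Proof. by move=> lt_sn; rewrite /rhoprod big_ltn. Qed.

Lemma shanks_rec n :
  shanks n.+1 = shanks n + 2%:R * (-1) ^+ n.+1 * fpsX ^+ (n.+1 ^ 2).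
Proof.
pose F m s := 2%:R * (-1) ^+ s * rhoprod s m * fpsX ^+ (s * m.+1) * inv1p s.
pose i := inv1p n.+1; pose y := fpsX ^+ n.+1.
have iE : (1 + y) * i = 1 by apply: inv1pE.
(* The differences between consecutive [n] telescope: their partial sums up to [m] have a closed
   form, found by induction on [m]. *)
have tele m : (m <= n)%N ->
    rhoprod 0 n.+1 - rhoprod 0 n + \sum_(1 <= s < m.+1) (F n.+1 s - F n s) =
    - 2%:R * i * (-1) ^+ m * rhoprod m n * fpsX ^+ (m.+1 * n.+1).
  elim: m => [_|m IHm lt_mn].
    rewrite big_geq // rhoprodS // /rho -/i mul1n -/y; apply/eqP; rewrite -subr_eq0.
    (* The two sides differ by a multiple of [(1 + y) * i - 1], which is zero; this takes the place
       of division by [1 + y], here and below. *)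
    apply/eqP; transitivity (rhoprod 0 n * ((1 + y) * i - 1)); first by ring.
    by rewrite iE subrr mulr0.
  rewrite big_nat_recr //= addrA IHm 1?ltnW //.
  rewrite /F rhoprodS // (rhoprod_recl lt_mn) /rho -/i -/y.
  have jE := inv1pE (ltn0Sn m); set j := inv1p m.+1 in jE *; set z := fpsX ^+ m.+1 in jE *.
  have -> : fpsX ^+ (m.+1 * n.+2) = z * fpsX ^+ (m.+1 * n.+1) by rewrite -exprD; congr (_ ^+ _); lia.
  have -> : fpsX ^+ (m.+2 * n.+1) = y * fpsX ^+ (m.+1 * n.+1) by rewrite -exprD; congr (_ ^+ _); lia.
  rewrite exprS; apply/eqP; rewrite -subr_eq0; apply/eqP.
  transitivity (2%:R * (-1) ^+ m * rhoprod m.+1 n * fpsX ^+ (m.+1 * n.+1)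
    * (i * y * ((1 + z) * j - 1) - j * ((1 + y) * i - 1))); first by ring.
  by rewrite iE jE subrr !mulr0 subrr mulr0.
have rnn k : rhoprod k k = 1 by rewrite /rhoprod big_geq.
have := tele n (leqnn n); rewrite sumrB addrACA => E.
rewrite /shanks big_nat_recr //= -/(F n.+1 n.+1) addrA.
have -> : rhoprod 0 n.+1 + \sum_(1 <= s < n.+1) F n.+1 s = shanks n
    - 2%:R * i * (-1) ^+ n * fpsX ^+ (n.+1 * n.+1).
  apply/eqP; rewrite -subr_eq0; apply/eqP; move: E.
  rewrite rnn mulr1.
  rewrite -opprD -/(shanks n) => E'.
  by rewrite opprB addrCA E'; ring.
rewrite -/(shanks n) /F rnn -/i.
have -> : fpsX ^+ (n.+1 * n.+2) = y * fpsX ^+ (n.+1 * n.+1) by rewrite -exprD; congr (_ ^+ _); lia.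
rewrite expnS expn1 exprS; apply/eqP; rewrite -subr_eq0; apply/eqP.
transitivity (-2%:R * (-1) ^+ n * fpsX ^+ (n.+1 * n.+1) * ((1 + y) * i - 1)); first by ring.
by rewrite iE subrr mulr0.
Qed.

Lemma shanksE n :
  shanks n = 1 + \sum_(1 <= s < n.+1) 2%:R * (-1) ^+ s * fpsX ^+ (s ^ 2).
Proof.
elim: n => [|n IHn]; first by rewrite /shanks /rhoprod !big_geq.
by rewrite shanks_rec IHn [in RHS]big_nat_recr //= addrA.
Qed.

(** The s-th extra term is a multiple of x^(s (n+1)), which lies beyond x^n. *)
Lemma eqm_shanks n : eqm n (shanks n) (rhoprod 0 n).
Proof.
move=> i le_in; rewrite coef_fpsD coef_fps_sum big_nat big1 ?addr0 // => s /andP[s_gt0 _].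
have mulrCA' (a b c : fps) : a * b * c = b * (a * c) by ring.
rewrite mulrCA' coef_fpsXnM.
by case: ifP => // /negbT; rewrite -leqNgt; nia.
Qed.

(** Factor by factor, (1 - y) / (1 + y) times 1 - y^2 is (1 - y)^2. *)
Lemma rhoprod_euler n : rhoprod 0 n * dbl (eulerN n) = eulerN n ^+ 2.
Proof.
elim: n => [|n IHn]; first by rewrite /rhoprod /eulerN !big_geq // rmorph1 expr1n mulr1.
rewrite rhoprodS // !eulerNS rmorphM exprMn -IHn rmorphB rmorph1 rmorphXn /= dbl_X -exprM.
rewrite mulnC exprM /rho; set j := inv1p _; set y := fpsX ^+ n.+1.
have jE : (1 + y) * j = 1 by apply: inv1pE.
transitivity (rhoprod 0 n * dbl (eulerN n) * (1 - y) ^+ 2 * ((1 + y) * j)); first by ring.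
by rewrite jE mulr1.
Qed.

Lemma mem_zfib a n : (a \in zfib n) = (nsq a == n).
Proof. by case: (zfib_fibered n). Qed.
Lemma zfib_uniq n : uniq (zfib n).
Proof. by case: (zfib_fibered n). Qed.

Lemma nsq_eq (a : int) (s : nat) : (nsq a == s ^ 2)%N = (a == s%:Z) || (a == - s%:Z).
Proof. by rewrite /nsq eqn_sqr; lia. Qed.

Lemma coef_th_sq w s : (0 < s)%N -> th w (s ^ 2)%N = w s%:Z + w (- s%:Z).
Proof.
move=> s_gt0; rewrite coef_gs (perm_big [:: s%:Z; - s%:Z]) 1?unlock /= ?addr0 //.
apply: uniq_perm; rewrite ?zfib_uniq //= ?andbT ?inE; first by lia.
by move=> a; rewrite mem_zfib nsq_eq !inE.
Qed.

Lemma coef_th0 w : th w 0%N = w 0.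
Proof. by rewrite coef_gs unlock /= addr0. Qed.

Lemma coef_th_nsq w n : (forall s, n <> s ^ 2)%N -> th w n = 0.
Proof.
move=> nsq_n; rewrite coef_gs big_seq big1 // => a.
by rewrite mem_zfib => /eqP E; case: (nsq_n `|a|%N).
Qed.

(** The sum of (-1)^a x^(a^2) over all integers, that is theta_4 with nome x instead of x^4. *)
Definition phim : fps := th3 - th2.

Lemma w32 s : w3 s%:Z - w2 s%:Z = (-1) ^+ s.
Proof.
have -> : (-1) ^+ s = (-1) ^+ (res4 s) :> int.
  by rewrite -signr_odd -[RHS]signr_odd; congr (_ ^+ _); rewrite /res4; lia.
by rewrite /w3 /w2; case: (res4 s) (res4_lt s) => [|[|[|[|]]]].
Qed.

Lemma phimE : phim = th (fun a => w3 a - w2 a).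
Proof. by rewrite /phim /th3 /th2 /th gsN gsD. Qed.

Lemma w_even_fun a : w3 (- a) - w2 (- a) = w3 a - w2 a.
Proof. by rewrite /w3 /w2 res4N; case: (res4 a) (res4_lt a) => [|[|[|[|]]]]. Qed.

Lemma coef_fps_signM s (f : fps) n : ((-1) ^+ s * f : fps) n = (-1) ^+ s * f n.
Proof. by rewrite -signr_odd -[in RHS]signr_odd; case: odd; rewrite ?mul1r ?mulN1r. Qed.

Lemma eqm_phim n : eqm n phim (shanks n).
Proof.
move=> i le_in; rewrite phimE shanksE coef_fpsD coef_fps1 coef_fps_sum.
have termE s : (2%:R * (-1) ^+ s * fpsX ^+ (s ^ 2) : fps) i = 2 * (-1) ^+ s * (i == s ^ 2)%N%:R.
  by rewrite -mulrA coef_fps_natM coef_fps_signM coef_fpsXn mulrA.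
under eq_bigr do rewrite termE.
have [->|i_gt0] := posnP i.
  rewrite coef_th0 (w32 0) big_nat big1 ?addr0 // => s /andP[s_gt0 _].
  by rewrite ltn_eqF ?mulr0 // expn_gt0 s_gt0.
case: (pselect (exists s, i = s ^ 2)%N) => [[s Ei]|nsq_i]; last first.
  rewrite coef_th_nsq => [|s Es]; last by apply: nsq_i; exists s.
  rewrite add0r big1 // => s _; case: eqP => [Es|]; rewrite ?mulr0 //.
  by case: nsq_i; exists s.
have s_gt0 : (0 < s)%N by case: s Ei => // Ei; rewrite Ei in i_gt0.
have le_sn : (s <= n)%N by nia.
have us : uniq (index_iota 1 n.+1) by apply: iota_uniq.
have ms : s \in index_iota 1 n.+1 by rewrite mem_index_iota s_gt0.
rewrite (bigD1_seq s ms us) big1 => [|t ne_ts]; last first.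
  by rewrite Ei eqn_sqr [s == t]eq_sym (negPf ne_ts) mulr0.
by rewrite Ei eqxx coef_th_sq // w_even_fun w32 /=; ring.
Qed.

Lemma gauss : phim * dbl euler = euler ^+ 2.
Proof.
apply: eqm_inj => N.
apply: (@eqm_trans _ _ (rhoprod 0 N * dbl (eulerN N))).
  apply: eqmM; first exact: eqm_trans (eqm_phim (n := N)) (eqm_shanks (n := N)).
  exact/eqm_dbl/eqm_sym/eqm_euler.
by rewrite rhoprod_euler; apply/eqmX/eqm_euler.
Qed.

(** * Theta series as Euler products, and E2 *)

Lemma dbl_dbl_th (w : int -> int) :
  dbl (dbl (th w)) = th (fun a => if odd (res4 a) then 0 else w (a %/ 2)%Z).
Proof.
apply/fpsP => n; have -> : dbl (dbl (th w)) n = if (4 %| n)%N then th w (n %/ 4)%N else 0.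
  rewrite !coef_dbl; have [/dvdnP[k ->]|n4] := boolP (4 %| n)%N.
    have -> : (k * 4 %/ 2 = k * 2)%N by lia.
    by rewrite !dvdn_mull // !mulnK.
  by case: ifP => // n2; case: ifP => // n22; lia.
case: ifP => [/dvdnP[k ->]|n4]; last first.
  rewrite coef_gs big_seq big1 // => a; rewrite mem_zfib => /eqP E.
  by case: ifP => // a2; move: n4; rewrite -E /nsq; move: a2; rewrite /res4; nia.
rewrite mulnK // !coef_gs [RHS](bigID (fun a => odd (res4 a))) /= [X in _ = X + _]big1 ?add0r; last by move=> a ->.
rewrite -[RHS]big_filter.
transitivity (\sum_(a <- zfib k) if odd (res4 (2 * a)) then 0 else w (2 * a %/ 2)%Z).
  apply: eq_bigr => a _; have -> : odd (res4 (2 * a)) = false by rewrite /res4; lia.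
  by congr w; lia.
symmetry; apply: (@sum_bij _ _ _ _ (fun a => 2 * a) (fun a => (a %/ 2)%Z)
  (fun a => if odd (res4 a) then 0 else w (a %/ 2)%Z)).
- exact: zfib_uniq.
- by rewrite filter_uniq ?zfib_uniq.
- move=> a; rewrite mem_zfib mem_filter mem_zfib /nsq => /eqP E; apply/andP; split.
    by rewrite /res4; lia.
  by apply/eqP; rewrite -E; lia.
- move=> a; rewrite mem_filter !mem_zfib /nsq => /andP[a2 /eqP E]; apply/eqP.
  have [b Eb] : exists b, a = 2 * b by exists (a %/ 2)%Z; move: a2; rewrite /res4; lia.
  have -> : (a %/ 2)%Z = b by lia.
  by move: E; rewrite Eb; lia.
- by move=> a _; lia.
- by move=> a; rewrite mem_filter /res4 => /andP[a2 _]; lia.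
Qed.

Lemma dbl_dbl_phim : dbl (dbl phim) = th4.
Proof.
rewrite phimE dbl_dbl_th; apply: eq_gs => a /=.
have [k Ek] : exists k, a = 4 * k + (res4 a)%:Z by exists (a %/ 4)%Z; rewrite /res4; lia.
rewrite /w3 /w2 /w4; have : (res4 (a %/ 2)%Z %% 2 = (res4 a) %/ 2)%N by rewrite /res4; lia.
have := res4_lt (a %/ 2)%Z; have := res4_lt a; clear.
by case: (res4 a) => [|[|[|[|//]]]]; case: (res4 _) => [|[|[|[|//]]]].
Qed.

Lemma dbl_dbl_phip : dbl (dbl (th3 + th2)) = th3.
Proof.
rewrite /th3 /th2 /th gsD -/(th _) dbl_dbl_th; apply: eq_gs => a /=.
rewrite /w3 /w2; have := res4_lt (a %/ 2)%Z; have := res4_lt a.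
by case: (res4 a) => [|[|[|[|//]]]]; case: (res4 _) => [|[|[|[|//]]]].
Qed.

Lemma gauss4 : th4 * dbl (dbl (dbl euler)) = dbl (dbl euler) ^+ 2.
Proof. by rewrite -dbl_dbl_phim -!rmorphM gauss -!rmorphXn. Qed.

Lemma coef_fps_exp0 (f : fps) k : (f ^+ k : fps) 0%N = f 0%N ^+ k.
Proof. by elim: k => [|k IHk]; rewrite ?coef_fps1 // !exprS coef_fpsM0 IHk. Qed.

(* Both sides solve [f ^+ 2 = 2 * dbl (f * th4 ^+ 3)] with [f = 2 x + ...]. *)
Lemma thA_euler : thA = 2%:R * fpsX * dbl (dbl (dbl euler)) ^+ 3.
Proof.
set R := RHS; apply/eqP; rewrite -subr_eq0; apply/eqP.
have euler0 : euler 0%N = 1 by rewrite /= /eulerp big_geq // coef1.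
have R0 : R 0%N = 0 by rewrite /R -mulrA coef_fps_natM coef_fpsM0 /= coefX mul0r mulr0.
have R1 : R 1%N = 2.
  rewrite /R -mulrA coef_fps_natM coef_fpsM1 coef_fps_exp0 !coef_dbl euler0 /= !coefX.
  by rewrite mul0r add0r.
(* Subtracting the two equations leaves a difference of squares, so [thA + R] multiplies the unknown
   [thA - R]. *)
apply: (@fps_dbl_uniq (thA + R) (2%:R * dbl (th4 ^+ 3))).
- by right; rewrite coef_fpsD thA_1 R1.
- by rewrite coef_fpsB thA_0 R0.
- by rewrite coef_fpsB thA_1 R1.
have EA : thA ^+ 2 = 2%:R * dbl (thA * th4 ^+ 3).
  rewrite {1}thA_prod -mulrA exprMn th2_sq th3_th4 thA_prod; dblE; ring.
have ER : R ^+ 2 = 2%:R * dbl (R * th4 ^+ 3).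
  have := congr1 dbl gauss4; rewrite /R; dblE => E; rewrite dbl_X.
  set P4 := dbl (dbl (dbl euler)) in E *; set P8 := dbl P4 in E *.
  transitivity (4%:R * fpsX ^+ 2 * (P4 ^+ 2) ^+ 3); first by ring.
  by rewrite -E; ring.
transitivity (thA ^+ 2 - R ^+ 2); first by ring.
by rewrite EA ER rmorphB !rmorphM /=; ring.
Qed.

Lemma dif_X : dif fpsX = fpsX.
Proof.
apply/fpsP => n; rewrite coef_dif /= coefX.
by case: eqP => [->|]; rewrite ?mulr0.
Qed.

Lemma fpsX_neq0 : fpsX != 0.
Proof. by apply: (@fps_neq0 _ 1); rewrite /= coefX. Qed.
Lemma euler_neq0 : euler != 0.
Proof. by apply: (@fps_neq0 _ 0); rewrite /= /eulerp big_geq // coef1. Qed.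
Lemma dbl_neq0 f : f != 0 -> dbl f != 0.
Proof. by apply: contraNneq => E; apply/eqP/dbl_inj; rewrite E rmorph0. Qed.

Lemma dif_dbl_euler :
  dif (dbl (dbl euler)) = - 4%:R * dbl (dbl euler) * dbl (dbl (Sg 1)).
Proof. by rewrite !dif_dbl dif_euler; dblE; ring. Qed.

Lemma thA_th4_euler : thA * th4 ^+ 3 = 2%:R * fpsX * dbl (dbl euler) ^+ 6.
Proof. by rewrite thA_euler -[6%N]/(2 * 3)%N exprM -gauss4 exprMn; ring. Qed.

(** The logarithmic derivative of [thA_th4_euler]; the right side is E2 at x^4, with 24 = 6 * 4 from
    the sixth power and the substitution. *)
Lemma E2_L : L2 + L3 + 4%:R * L4 = 1 - 24%:R * dbl (dbl (Sg 1)).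
Proof.
have nz : thA * th4 ^+ 3 != 0.
  rewrite thA_th4_euler -!mulrA; apply: fps_mulf_neq0 fps2_neq0 _.
  apply: fps_mulf_neq0 fpsX_neq0 _.
  have nz := dbl_neq0 (dbl_neq0 euler_neq0).
  by do 6 (rewrite exprS; apply: fps_mulf_neq0 => //); rewrite expr0 oner_neq0.
apply: (fps_mulfI nz).
have -> : thA * th4 ^+ 3 * (L2 + L3 + 4%:R * L4) = dif (thA * th4 ^+ 3).
  by rewrite difM difX dif_thA dif_th4; ring.
rewrite thA_th4_euler -mulrA dif_nat difM difX dif_dbl_euler dif_X; ring.
Qed.

Lemma L4_euler : L4 = 8%:R * (dbl (dbl (dbl (Sg 1))) - dbl (dbl (Sg 1))).
Proof.
have nz : th4 * dbl (dbl (dbl euler)) != 0.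
  by apply: fps_mulf_neq0 th4_neq0 _; do 3 apply: dbl_neq0; apply: euler_neq0.
apply: (fps_mulfI nz); have := congr1 dif gauss4.
rewrite difM difX dif_th4 [dif (dbl (dbl (dbl euler)))]dif_dbl dif_dbl_euler.
dblE => E.
have E' : th4 * dbl (dbl (dbl euler)) * L4 =
  8%:R * dbl (dbl (dbl (Sg 1))) * (th4 * dbl (dbl (dbl euler)))
  - 8%:R * dbl (dbl (Sg 1)) * dbl (dbl euler) ^+ 2.
  by apply/eqP; rewrite -subr_eq0; apply/eqP; move/eqP: E; rewrite -subr_eq0 => /eqP <-; ring.
by rewrite E' -gauss4; ring.
Qed.

(** * Liouville's identity and E4 *)

(* The pair [(a, x)] stands for the factorization [(a + 1) * (x + 1)]. *)
Definition npr (z : nat * nat) : nat := (z.1.+1 * z.2.+1)%N.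
Definition dfib (n : nat) : seq (nat * nat) :=
  if n is 0%N then [::] else [seq (d.-1, (n %/ d).-1) | d <- divisors n].

Lemma dfib_fibered : fibered npr dfib.
Proof.
case=> [|n]; first by split=> // -[a x].
split=> [|[a x]].
  rewrite map_inj_in_uniq ?divisors_uniq // => d e; rewrite -!dvdn_divisors // => dn en [E _].
  by rewrite -(prednK (dvdn_gt0 _ dn)) // E prednK // (dvdn_gt0 _ en).
apply/mapP/eqP => [[d]|E].
  rewrite -dvdn_divisors // => dn [-> ->]; have d_gt0 := dvdn_gt0 (ltn0Sn n) dn.
  have q_gt0 : (0 < n.+1 %/ d)%N by rewrite divn_gt0 // dvdn_leq.
  by rewrite /npr (prednK d_gt0) (prednK q_gt0) mulnC divnK.
exists a.+1; first by rewrite -dvdn_divisors // -E dvdn_mulr.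
by rewrite -E /npr mulKn.
Qed.

Lemma SgE k : Sg k = gs dfib (fun z => z.1.+1%:Z ^+ k).
Proof.
apply/fpsP => -[|n]; first by rewrite coef_gs /= big_nil.
rewrite coef_gs big_map /= /sig -natz natr_sum; apply: eq_big_seq => d.
by rewrite -dvdn_divisors // => /(dvdn_gt0 (ltn0Sn n)) d_gt0; rewrite prednK // natrX natz.
Qed.

(** Positive quadruples with a x + b y = n, each entry stored minus one; summing over them gives the
    convolution of sigma with itself. *)
Definition qfib := pairfib dfib dfib.
Definition nq (q : (nat * nat) * (nat * nat)) : nat := (npr q.1 + npr q.2)%N.
Lemma qfib_fibered : fibered nq qfib.
Proof. exact: pairfib_fibered dfib_fibered dfib_fibered. Qed.

Lemma qsum_bij n (P Q : pred ((nat * nat) * (nat * nat))) h g (F : _ -> int) :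
  (forall q, P q -> [/\ Q (h q), nq (h q) = nq q & g (h q) = q]) ->
  (forall q, Q q -> [/\ P (g q), nq (g q) = nq q & h (g q) = q]) ->
  \sum_(q <- qfib n | Q q) F q = \sum_(q <- qfib n | P q) F (h q).
Proof.
move=> hP gP; have [us ms] := qfib_fibered n; rewrite -[LHS]big_filter -[RHS]big_filter.
apply: (@sum_bij _ _ _ _ h g F); rewrite ?filter_uniq // => q; rewrite mem_filter => /andP[].
- by rewrite mem_filter !ms => /hP[-> -> _].
- by rewrite mem_filter !ms => /gP[-> -> _].
- by case/hP.
- by case/gP.
Qed.

(* Both shears preserve [a x + b y]: replace [(a, x, b, y)] by [(a, x - y, a + b, y)],
   respectively by [(a - b, x, b, x + y)]. *)
Lemma liouville_shear n (F : _ -> int) :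
  \sum_(q <- qfib n | (q.1.1 < q.2.1)%N) F q =
  \sum_(q <- qfib n | (q.2.2 < q.1.2)%N)
     F ((q.1.1, (q.1.2 - q.2.2).-1)%N, ((q.1.1 + q.2.1).+1, q.2.2)%N).
Proof.
apply: (@qsum_bij n _ _ _ (fun q => ((q.1.1, (q.1.2 + q.2.2).+1)%N, ((q.2.1 - q.1.1).-1, q.2.2)%N))).
- move=> [[a x] [b y]] /= lt_yx; split; first by lia.
    have [k ->] : exists k, x = (y + k.+1)%N by exists (x - y).-1; lia.
    by rewrite /nq /npr /= addKn /= !(mulSn, mulnS, mulnDl, mulnDr); lia.
  by congr (_, _, (_, _)); lia.
- move=> [[a x] [b y]] /= lt_ab; split; first by lia.
    have [k ->] : exists k, b = (a + k.+1)%N by exists (b - a).-1; lia.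
    by rewrite /nq /npr /= addKn /= !(mulSn, mulnS, mulnDl, mulnDr); lia.
  by congr (_, _, (_, _)); lia.
Qed.

Lemma liouville_shear_r n (F : nat -> int) :
  \sum_(q <- qfib n | (q.2.1 < q.1.1)%N) F q.2.1 =
  \sum_(q <- qfib n | (q.1.2 < q.2.2)%N) F q.2.1.
Proof.
apply/esym/(@qsum_bij n _ _ (fun q => (((q.1.1 - q.2.1).-1, q.1.2)%N, (q.2.1, (q.1.2 + q.2.2).+1)%N))
  (fun q => (((q.1.1 + q.2.1).+1, q.1.2)%N, (q.2.1, (q.2.2 - q.1.2).-1)%N)) (fun q => F q.2.1)).
- move=> [[a x] [b y]] /= lt_ba; split; first by lia.
    have [k ->] : exists k, a = (b + k.+1)%N by exists (a - b).-1; lia.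
    by rewrite /nq /npr /= addKn /= !(mulSn, mulnS, mulnDl, mulnDr); lia.
  by congr (_, _, (_, _)); lia.
- move=> [[a x] [b y]] /= lt_xy; split; first by lia.
    have [k ->] : exists k, y = (x + k.+1)%N by exists (y - x).-1; lia.
    by rewrite /nq /npr /= addKn /= !(mulSn, mulnS, mulnDl, mulnDr); lia.
  by congr (_, _, (_, _)); lia.
Qed.

Lemma qfib_swap n (P : pred _) (F : _ -> int) :
  \sum_(q <- qfib n | P q) F q = \sum_(q <- qfib n | P (q.2, q.1)) F (q.2, q.1).
Proof.
apply: (@qsum_bij n (fun q => P (q.2, q.1)) P (fun q => (q.2, q.1)) (fun q => (q.2, q.1))).
  by move=> [z w] /= ->; rewrite /nq addnC.
by move=> [z w] /= ->; rewrite /nq addnC.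
Qed.

Lemma sum_trichotomy (T : Type) (s : seq T) (u v : T -> nat) (F : T -> int) :
  \sum_(q <- s) F q = \sum_(q <- s | (u q < v q)%N) F q
    + \sum_(q <- s | (v q < u q)%N) F q + \sum_(q <- s | u q == v q) F q.
Proof.
rewrite (bigID (fun q => (u q < v q)%N)) /= -addrA; congr (_ + _).
rewrite (bigID (fun q => (v q < u q)%N)) /=; congr (_ + _); apply: eq_bigl => q; lia.
Qed.

(** Write 4 a b as (a + b)^2 - (a - b)^2. The shears match the terms off the diagonals x = y and a =
    b, and only the diagonals remain. *)
Lemma liouville n :
  4 * \sum_(q <- qfib n) q.1.1.+1%:Z * q.2.1.+1%:Z =
  \sum_(q <- qfib n | q.1.2 == q.2.2)
     ((q.1.1.+1%:Z + q.2.1.+1%:Z) ^+ 2 + 2 * q.2.1.+1%:Z ^+ 2)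
  - 2 * \sum_(q <- qfib n | q.1.1 == q.2.1) q.2.1.+1%:Z ^+ 2.
Proof.
pose A (q : (nat * nat) * (nat * nat)) := q.1.1.+1%:Z.
pose B (q : (nat * nat) * (nat * nat)) := q.2.1.+1%:Z.
rewrite big_split -mulr_sumr /=.
have E0 : 4 * \sum_(q <- qfib n) A q * B q =
    \sum_(q <- qfib n) (A q + B q) ^+ 2 - \sum_(q <- qfib n) (A q - B q) ^+ 2.
  by rewrite -sumrB mulr_sumr; apply: eq_bigr => q _; ring.
have Eplus : \sum_(q <- qfib n) (A q + B q) ^+ 2 =
    \sum_(q <- qfib n | q.1.2 == q.2.2) (A q + B q) ^+ 2
    + 2 * \sum_(q <- qfib n | (q.1.1 < q.2.1)%N) B q ^+ 2.
  have s1 : \sum_(q <- qfib n | (q.1.2 < q.2.2)%N) (A q + B q) ^+ 2 =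
      \sum_(q <- qfib n | (q.2.2 < q.1.2)%N) (A q + B q) ^+ 2.
    by rewrite [LHS]qfib_swap; apply: eq_bigr => q _; rewrite addrC.
  have s2 : \sum_(q <- qfib n | (q.1.1 < q.2.1)%N) B q ^+ 2 =
      \sum_(q <- qfib n | (q.2.2 < q.1.2)%N) (A q + B q) ^+ 2.
    by rewrite liouville_shear; apply: eq_bigr => q _; rewrite /A /B /=; congr (_ ^+ 2); lia.
  by rewrite (sum_trichotomy _ (fun q => q.1.2) (fun q => q.2.2)) s1 s2; ring.
have Eminus : \sum_(q <- qfib n) (A q - B q) ^+ 2 =
    2 * \sum_(q <- qfib n | (q.2.2 < q.1.2)%N) B q ^+ 2.
  have s1 : \sum_(q <- qfib n | (q.2.1 < q.1.1)%N) (A q - B q) ^+ 2 =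
      \sum_(q <- qfib n | (q.1.1 < q.2.1)%N) (A q - B q) ^+ 2.
    by rewrite [LHS]qfib_swap; apply: eq_bigr => q _; rewrite -sqrrN opprB.
  have s2 : \sum_(q <- qfib n | (q.1.1 < q.2.1)%N) (A q - B q) ^+ 2 =
      \sum_(q <- qfib n | (q.2.2 < q.1.2)%N) B q ^+ 2.
    rewrite liouville_shear; apply: eq_bigr => q _.
    by rewrite -[LHS]sqrrN; congr (_ ^+ 2); rewrite /A /B /=; lia.
  rewrite (sum_trichotomy _ (fun q => q.1.1) (fun q => q.2.1)) s1 s2 [X in _ + X]big1; first by ring.
  by move=> q /eqP E; rewrite /A /B E subrr.
have EB : \sum_(q <- qfib n | (q.1.1 < q.2.1)%N) B q ^+ 2
     + \sum_(q <- qfib n | q.1.1 == q.2.1) B q ^+ 2 =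
   \sum_(q <- qfib n | (q.2.2 < q.1.2)%N) B q ^+ 2
     + \sum_(q <- qfib n | q.1.2 == q.2.2) B q ^+ 2.
  (* The terms with b < a complete the left side to the sum over all quadruples; by
     [liouville_shear_r] they equal the terms with x < y, which complete the right side. *)
  apply: (addIr (\sum_(q <- qfib n | (q.2.1 < q.1.1)%N) B q ^+ 2)).
  rewrite [in RHS](liouville_shear_r n (fun b => b.+1%:Z ^+ 2)).
  transitivity (\sum_(q <- qfib n) B q ^+ 2).
    by rewrite (sum_trichotomy _ (fun q => q.1.1) (fun q => q.2.1)); ring.
  by rewrite (sum_trichotomy _ (fun q => q.2.2) (fun q => q.1.2)) /=;
    rewrite [X in _ + X = _](eq_bigl _ _ (fun q => eq_sym q.2.2 q.1.2)); ring.
rewrite /A /B /= in E0 Eplus Eminus EB; rewrite E0 Eplus Eminus; lra.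
Qed.

Lemma sum_affine_sq (k : int) m :
  3 * \sum_(0 <= b < m) (k + 2 * b.+1%:Z ^+ 2) =
  3 * m%:Z * k + m%:Z * (m%:Z + 1) * (2 * m%:Z + 1).
Proof.
elim: m => [|m IHm]; first by rewrite big_geq ?mulr0 ?mul0r.
rewrite big_nat_recr //= mulrDr IHm.
have -> : m.+1%:Z = m%:Z + 1 by lia.
ring.
Qed.

(** If x = y then (a + b) x = n: the quadruple is a divisor d = a + b of n with a choice of 1 <= b <
    d, and d^2 + 2 b^2 is summed over b. *)
Lemma sum_eq_cofactor n :
  3 * \sum_(q <- qfib n | q.1.2 == q.2.2)
     ((q.1.1.+1%:Z + q.2.1.+1%:Z) ^+ 2 + 2 * q.2.1.+1%:Z ^+ 2) =
  \sum_(z <- dfib n) (5 * z.1.+1%:Z ^+ 3 - 6 * z.1.+1%:Z ^+ 2 + z.1.+1%:Z).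
Proof.
have [uf mf] := dfib_fibered n; have [us ms] := qfib_fibered n.
pose t := [seq (z, b) | z <- dfib n, b <- iota 0 z.1].
have ut : uniq t.
  by apply: allpairs_uniq_dep => // [z _|[z b] [w c] _ _ [-> ->]]; rewrite ?iota_uniq.
have mt z b : ((z, b) \in t) = (z \in dfib n) && (b < z.1)%N.
  apply/allpairsPdep/andP => [[w [c [wf cw [-> ->]]]]|[zf bz]].
    by move: cw; rewrite mem_iota.
  by exists z, b; rewrite mem_iota.
rewrite -big_filter (@sum_bij _ _ t _
  (fun u => (((u.1.1 - u.2).-1, u.1.2), (u.2, u.1.2))%N)
  (fun q => (((q.1.1 + q.2.1).+1, q.1.2), q.2.1))) ?filter_uniq //; first last.
- move=> [[a x] [b y]]; rewrite mem_filter => /andP[/= /eqP <- _].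
  by congr (_, _, _); lia.
- move=> [[a x] b]; rewrite mt /= => /andP[_ lt_ba].
  by congr (_, _, _); lia.
- move=> [[a x] [b y]]; rewrite mem_filter ms mt mf => /andP[/= /eqP <- /eqP E].
  rewrite ltnS leq_addl andbT; apply/eqP; rewrite -E /nq /npr /=.
  by rewrite !(mulSn, mulnS, mulnDl, mulnDr); lia.
- move=> [[a x] b]; rewrite mt mf mem_filter ms /= eqxx => /andP[/eqP E lt_ba].
  apply/eqP; rewrite -E /nq /npr /=.
  have [k ->] : exists k, a = (b + k.+1)%N by exists (a - b).-1; lia.
  by rewrite addKn /= !(mulSn, mulnS, mulnDl, mulnDr); lia.
rewrite big_allpairs_dep mulr_sumr; apply: eq_bigr => -[d x] _ /=.
rewrite (eq_big_seq (fun b : nat => d.+1%:Z ^+ 2 + 2 * b.+1%:Z ^+ 2)); last first.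
  by move=> b; rewrite mem_iota => /= lt_bd; congr (_ ^+ 2 + _); lia.
have -> : iota 0 d = index_iota 0 d by rewrite /index_iota subn0.
by rewrite sum_affine_sq (_ : d.+1%:Z = d%:Z + 1); [ring|lia].
Qed.

(** If a = b then a (x + y) = n, which leaves n / a - 1 choices of y for each divisor a. *)
Lemma sum_eq_factor n :
  2 * \sum_(q <- qfib n | q.1.1 == q.2.1) q.2.1.+1%:Z ^+ 2 =
  \sum_(z <- dfib n) 2 * (n%:Z * z.1.+1%:Z - z.1.+1%:Z ^+ 2).
Proof.
have [uf mf] := dfib_fibered n; have [us ms] := qfib_fibered n.
pose t := [seq (z, y) | z <- dfib n, y <- iota 0 z.2].
have ut : uniq t.
  by apply: allpairs_uniq_dep => // [z _|[z b] [w c] _ _ [-> ->]]; rewrite ?iota_uniq.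
have mt z y : ((z, y) \in t) = (z \in dfib n) && (y < z.2)%N.
  apply/allpairsPdep/andP => [[w [c [wf cw [-> ->]]]]|[zf bz]].
    by move: cw; rewrite mem_iota.
  by exists z, y; rewrite mem_iota.
rewrite -big_filter (@sum_bij _ _ t _
  (fun u => ((u.1.1, (u.1.2 - u.2).-1), (u.1.1, u.2))%N)
  (fun q => ((q.1.1, (q.1.2 + q.2.2).+1), q.2.2))) ?filter_uniq //; first last.
- move=> [[a x] [b y]]; rewrite mem_filter => /andP[/= /eqP <- _].
  by congr (_, _, (_, _)); lia.
- move=> [[a x] b]; rewrite mt /= => /andP[_ lt_ba].
  by congr (_, _, _); lia.
- move=> [[a x] [b y]]; rewrite mem_filter ms mt mf => /andP[/= /eqP <- /eqP E].
  rewrite ltnS leq_addl andbT; apply/eqP; rewrite -E /nq /npr /=.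
  by rewrite !(mulSn, mulnS, mulnDl, mulnDr); lia.
- move=> [[a x] y]; rewrite mt mf mem_filter ms /= eqxx => /andP[/eqP E lt_yx].
  apply/eqP; rewrite -E /nq /npr /=.
  have [k ->] : exists k, x = (y + k.+1)%N by exists (x - y).-1; lia.
  by rewrite addKn /= !(mulSn, mulnS, mulnDl, mulnDr); lia.
rewrite big_allpairs_dep mulr_sumr; apply: eq_big_seq => -[d x]; rewrite mf => /eqP E /=.
rewrite big_const_seq count_predT size_iota iter_addr_0 -E /npr /= PoszM.
by rewrite -[_ *+ x]mulr_natl natz (_ : x.+1%:Z = x%:Z + 1); [ring|lia].
Qed.

(** The sums of d^2 contributed by the two diagonals in [liouville] cancel. *)
Lemma Sg1_sq : 12%:R * Sg 1 ^+ 2 = 5%:R * Sg 3 + Sg 1 - 6%:R * dif (Sg 1).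
Proof.
apply/fpsP => n; rewrite coef_fpsB coef_fpsD !coef_fps_natM coef_dif !SgE expr2 gsM !coef_gs.
rewrite -/qfib; under eq_bigr => q _ do rewrite !expr1.
have := liouville n; have := sum_eq_cofactor n; have := sum_eq_factor n.
set U := \sum_(q <- qfib n) _; set V := \sum_(q <- qfib n | _) _ => E1 E2.
set W := \sum_(q <- qfib n | _) _ in E2 *; rewrite E1 => E3.
have -> : 12%:R * U = 3 * (4 * U) by ring.
rewrite E3 mulrBr E2 natz !mulr_sumr -sumrB -!big_split -sumrB /=.
by apply: eq_bigr => z _; rewrite expr1; ring.
Qed.

(** * E4 and the series F in terms of theta series *)

Definition E4s : fps := Fps E4.

Lemma E4sE : E4s = 1 + 240%:R * Sg 3.
Proof.
apply/fpsP => -[|n]; rewrite coef_fpsD coef_fps1 coef_fps_natM /= /E4 /= ?mulr0 ?addr0 ?add0r //.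
Qed.

(** Ramanujan's relation at x^4: [dif] gains a factor 4 under this substitution, so 12 becomes 3. *)
Lemma E4_L : dbl (dbl E4s) =
  (L2 + L3 + 4%:R * L4) ^+ 2 - 3%:R * dif (L2 + L3 + 4%:R * L4).
Proof.
have /(congr1 (fun f => dbl (dbl f))) := Sg1_sq; rewrite E2_L E4sE.
rewrite (raddfB dif) /= dif1 dif_nat !dif_dbl; dblE => E.
set s := dbl (dbl (Sg 1)) in E *; set d := dbl (dbl (dif (Sg 1))) in E *.
set t := dbl (dbl (Sg 3)) in E *.
(* The multiplier is 48 because 48 * 12 = 24^2 is the coefficient of [s ^+ 2] in the square of
   E2. *)
have := congr1 (fun w => 1 + 240%:R * t + 48%:R * (w - (5%:R * t + s - 6%:R * d))) E.
by move=> E'; apply: etrans (etrans (esym E') _); ring.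
Qed.

Lemma E4_theta : dbl (dbl E4s) = th3 ^+ 8 + 14%:R * th3 ^+ 4 * th2 ^+ 4 + th2 ^+ 8.
Proof.
rewrite E4_L 2!(raddfD dif) /= dif_nat dif_L2 dif_L3 dif_L4 (exprM _ 4 2) (exprM th2 4 2) th3_4 th2_4.
by ring.
Qed.

(** The series F. Its odd exponents turn the passage from n to p n + (p - 1) / 2 into multiplication
    by p, as 2 (p n + (p - 1) / 2) + 1 = p (2 n + 1). *)
Definition cser : fps := fpsX * dbl (Fps c_nat).

(** Gauss' identity at x^2 trades [dbl euler ^+ 8] for [dbl phim ^+ 4], and [dbl phim ^+ 2] is
    [th3 ^+ 2 - th2 ^+ 2]; the remaining powers of [dbl (dbl euler)] are absorbed by
    [thA_th4_euler]. *)
Lemma cser_theta :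
  2%:R * cser = dbl (dbl E4s) * th4 ^+ 3 * thA * (th3 ^+ 2 - th2 ^+ 2) ^+ 2.
Proof.
rewrite /cser; have -> : Fps c_nat = dbl E4s * (euler ^+ 8 * dbl euler ^+ 2).
  by rewrite -etaprodE.
have E : dbl phim ^+ 2 = th3 ^+ 2 - th2 ^+ 2.
  by apply: dbl_inj; rewrite -th4_sq rmorphXn /= dbl_dbl_phim.
have EG : dbl phim * dbl (dbl euler) = dbl euler ^+ 2 by rewrite -rmorphM gauss rmorphXn.
have EA := thA_th4_euler; rewrite -E !(rmorphXn dbl, rmorphM dbl) /=.
transitivity (dbl (dbl E4s) * (dbl phim * dbl (dbl euler)) ^+ 4 * (2%:R * fpsX * dbl (dbl euler) ^+ 2)).
  by rewrite EG; ring.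
have -> : dbl (dbl E4s) * th4 ^+ 3 * thA * (dbl phim ^+ 2) ^+ 2 =
  dbl (dbl E4s) * (dbl phim ^+ 2) ^+ 2 * (thA * th4 ^+ 3) by ring.
by rewrite EA; ring.
Qed.

(** * Theta series of quaternions *)

(* [((a, b), (c, d))] is the quaternion [a + b i + c j + d k]. *)
Notation quat := ((int * int) * (int * int))%type.

(* Up to a factor, the harmonic polynomial of degree 7 which is invariant under the
   rotations of [i, j, k] and transforms on the right by the 4-dimensional irreducible
   representation of the binary octahedral group in degree 7. *)
Definition polyT (z : quat) : int :=
  let: ((a, b), (c, d)) := z in
  3 * a ^+ 7 - 21 * a ^+ 5 * (b ^+ 2 + c ^+ 2 + d ^+ 2)
  + 25 * a ^+ 3 * (b ^+ 4 + c ^+ 4 + d ^+ 4)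
  + 30 * a ^+ 3 * (b ^+ 2 * c ^+ 2 + c ^+ 2 * d ^+ 2 + d ^+ 2 * b ^+ 2)
  - 7 * a * (b ^+ 6 + c ^+ 6 + d ^+ 6)
  + 15 * a * (b ^+ 2 * c ^+ 4 + b ^+ 4 * c ^+ 2 + c ^+ 2 * d ^+ 4
      + c ^+ 4 * d ^+ 2 + d ^+ 2 * b ^+ 4 + d ^+ 4 * b ^+ 2)
  - 270 * a * b ^+ 2 * c ^+ 2 * d ^+ 2.

(* Harmonic of degree 7, in the same representation on the right as [polyT]. *)
Definition polyW (z : quat) : int :=
  let: ((a, b), (c, d)) := z in
  b * c * d * (45 * a ^+ 4 - 30 * a ^+ 2 * (b ^+ 2 + c ^+ 2 + d ^+ 2)
    + 9 * (b ^+ 4 + c ^+ 4 + d ^+ 4)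
    - 10 * (b ^+ 2 * c ^+ 2 + c ^+ 2 * d ^+ 2 + d ^+ 2 * b ^+ 2)).

Lemma dif_th w : dif (th w) = th (fun a => a ^+ 2 * w a).
Proof. by rewrite (dif_gs _ zfib_fibered); apply: eq_gs => a; rewrite natz nsqE. Qed.

Lemma th_prod4 u v s t :
  th u * th v * (th s * th t) =
  gs fib4 (fun z : quat => u z.1.1 * v z.1.2 * (s z.2.1 * t z.2.2)).
Proof. by rewrite !thM gsM. Qed.

Definition wtX (z : quat) : int := chi z.1.1 * w4 z.1.2 * (w4 z.2.1 * w4 z.2.2).
Definition wtX' (z : quat) : int := w4 z.1.1 * chi z.1.2 * (chi z.2.1 * chi z.2.2).

Lemma dif3_th w : dif (dif (dif (th w))) = th (fun a => a ^+ 6 * w a).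
Proof. by rewrite !dif_th; apply: eq_gs => a; ring. Qed.
Lemma dif2_th w : dif (dif (th w)) = th (fun a => a ^+ 4 * w a).
Proof. by rewrite !dif_th; apply: eq_gs => a; ring. Qed.

Lemma gsMn (T : eqType) (f : nat -> seq T) v k :
  gs f v *+ k = gs f (fun x => v x *+ k).
Proof. by apply/fpsP => n; rewrite coef_fpsMn !coef_gs sumrMnl. Qed.

Definition dA0 := thA. Definition dA1 := dif dA0. Definition dA2 := dif dA1. Definition dA3 := dif dA2.
Definition dB0 := th4. Definition dB1 := dif dB0. Definition dB2 := dif dB1. Definition dB3 := dif dB2.

(** Applying [dif] multiplies the weight at [a] by [a ^+ 2]. As [polyT] is odd in its first
    coordinate and even in the others, each monomial is a product of derivatives of one [thA] and
    three [th4]. *)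
Lemma gs_polyT_dif : gs fib4 (fun z => wtX z * polyT z) =
  (dA3 * dB0 * (dB0 * dB0)) *+ 3
  - (dA2 * dB1 * (dB0 * dB0) + dA2 * dB0 * (dB1 * dB0) + dA2 * dB0 * (dB0 * dB1)) *+ 21
  + (dA1 * dB2 * (dB0 * dB0) + dA1 * dB0 * (dB2 * dB0) + dA1 * dB0 * (dB0 * dB2)) *+ 25
  + (dA1 * dB1 * (dB1 * dB0) + dA1 * dB0 * (dB1 * dB1) + dA1 * dB1 * (dB0 * dB1)) *+ 30
  - (dA0 * dB3 * (dB0 * dB0) + dA0 * dB0 * (dB3 * dB0) + dA0 * dB0 * (dB0 * dB3)) *+ 7
  + (dA0 * dB1 * (dB2 * dB0) + dA0 * dB2 * (dB1 * dB0) + dA0 * dB0 * (dB1 * dB2)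
     + dA0 * dB0 * (dB2 * dB1) + dA0 * dB2 * (dB0 * dB1) + dA0 * dB1 * (dB0 * dB2)) *+ 15
  - (dA0 * dB1 * (dB1 * dB1)) *+ 270.
Proof.
rewrite /dA3 /dA2 /dA1 /dA0 /dB3 /dB2 /dB1 /dB0 /thA /th4 !dif3_th !dif2_th !dif_th.
rewrite !th_prod4 !gsD !gsMn !gsN !gsD; apply: eq_gs => -[[a b] [c d]].
by rewrite /wtX /polyT /=; ring.
Qed.

Lemma gs_polyW_dif : gs fib4 (fun z => wtX' z * polyW z) =
  (dB2 * dA0 * (dA0 * dA0)) *+ 45
  - (dB1 * dA1 * (dA0 * dA0) + dB1 * dA0 * (dA1 * dA0) + dB1 * dA0 * (dA0 * dA1)) *+ 30
  + (dB0 * dA2 * (dA0 * dA0) + dB0 * dA0 * (dA2 * dA0) + dB0 * dA0 * (dA0 * dA2)) *+ 9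
  - (dB0 * dA1 * (dA1 * dA0) + dB0 * dA0 * (dA1 * dA1) + dB0 * dA1 * (dA0 * dA1)) *+ 10.
Proof.
rewrite /dA2 /dA1 /dA0 /dB2 /dB1 /dB0 /thA /th4 !dif2_th !dif_th.
rewrite !th_prod4 !gsD !gsMn !gsN !gsD; apply: eq_gs => -[[a b] [c d]].
by rewrite /wtX' /polyW /=; ring.
Qed.

Definition lA : fps := L2 + L3 + L4.

Lemma dif_lA : dif lA = 2%:R * (L2 * L3 + L2 * L4 + L3 * L4).
Proof. by rewrite /lA 2!(raddfD dif) /= dif_L2 dif_L3 dif_L4; ring. Qed.

Lemma difs_thA :
  [/\ dA1 = lA * thA, dA2 = (dif lA + lA ^+ 2) * thA
    & dA3 = (dif (dif lA) + 3%:R * lA * dif lA + lA ^+ 3) * thA].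
Proof.
have E1 : dA1 = lA * thA by apply: dif_thA.
have E2 : dA2 = (dif lA + lA ^+ 2) * thA by rewrite /dA2 E1 difM dif_thA -/lA; ring.
split=> //; rewrite /dA3 E2 difM (raddfD dif) /= difX dif_thA -/lA; ring.
Qed.

Lemma difs_th4 :
  [/\ dB1 = L4 * th4, dB2 = (dif L4 + L4 ^+ 2) * th4
    & dB3 = (dif (dif L4) + 3%:R * L4 * dif L4 + L4 ^+ 3) * th4].
Proof.
have E1 : dB1 = L4 * th4 by apply: dif_th4.
have E2 : dB2 = (dif L4 + L4 ^+ 2) * th4 by rewrite /dB2 E1 difM dif_th4; ring.
split=> //; rewrite /dB3 E2 difM (raddfD dif) /= difX dif_th4; ring.
Qed.

Lemma dif2_L4 : dif (dif L4) =
  2%:R * (dif L4 * (L2 + L3) + L4 * (dif L2 + dif L3) - dif L2 * L3 - L2 * dif L3).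
Proof. by rewrite {1}dif_L4 dif_nat (raddfB dif) (raddfD dif) /= !difM; ring. Qed.

Lemma dif2_lA : dif (dif lA) =
  2%:R * (dif L2 * L3 + L2 * dif L3 + dif L2 * L4 + L2 * dif L4 + dif L3 * L4 + L3 * dif L4).
Proof. by rewrite dif_lA dif_nat 2!(raddfD dif) /= !difM; ring. Qed.

(** By the Halphen system both sides are [thA * th4 ^+ 3] times cubic polynomials in [L2], [L3],
    [L4], and these agree. *)
Lemma gs_polyT : gs fib4 (fun z => wtX z * polyT z) =
  3%:R * (dbl (dbl E4s) * th4 ^+ 3 * thA * (th3 ^+ 4 + th2 ^+ 4)).
Proof.
have [EA1 EA2 EA3] := difs_thA; have [EB1 EB2 EB3] := difs_th4.
rewrite gs_polyT_dif EA1 EA2 EA3 EB1 EB2 EB3 dif2_lA dif2_L4 dif_lA dif_L2 dif_L3 dif_L4.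
rewrite E4_theta (exprM th3 4 2) (exprM th2 4 2) th3_4 th2_4 /dA0 /dB0 /lA.
ring.
Qed.

Lemma gs_polyW : gs fib4 (fun z => wtX' z * polyW z) =
  - (3%:R * (dbl (dbl E4s) * th4 * thA ^+ 3)).
Proof.
have [EA1 EA2 _] := difs_thA; have [EB1 EB2 _] := difs_th4.
rewrite gs_polyW_dif EA1 EA2 EB1 EB2 dif_lA dif_L4.
rewrite E4_theta (exprM th3 4 2) (exprM th2 4 2) th3_4 th2_4 /dA0 /dB0 /lA.
ring.
Qed.

(* [inX] and [inX'] are the classes of [1] and of [i + j + k] modulo the two-sided ideal
   generated by [2 (1 + i)] in the Hurwitz order. *)
Definition inX (z : quat) : bool :=
  [&& odd (res4 z.1.1), ~~ odd (res4 z.1.2), ~~ odd (res4 z.2.1), ~~ odd (res4 z.2.2)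
    & (res4 z.1.1 + res4 z.1.2 + res4 z.2.1 + res4 z.2.2) %% 4 == 1]%N.
Definition inX' (z : quat) : bool :=
  [&& ~~ odd (res4 z.1.1), odd (res4 z.1.2), odd (res4 z.2.1), odd (res4 z.2.2)
    & (res4 z.1.1 + res4 z.1.2 + res4 z.2.1 + res4 z.2.2) %% 4 == 3]%N.

Definition qneg (z : quat) : quat := ((- z.1.1, - z.1.2), (- z.2.1, - z.2.2)).

Ltac res4_cases4 a b c d :=
  have := res4_lt a; have := res4_lt b; have := res4_lt c; have := res4_lt d;
  case: (res4 a) => [|[|[|[|//]]]]; case: (res4 b) => [|[|[|[|//]]]];
  case: (res4 c) => [|[|[|[|//]]]]; case: (res4 d) => [|[|[|[|//]]]].

(** The weight lives on a class and its negative with opposite signs; as [polyT] is odd, the two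
    contribute equally. *)
Lemma wtX_E z : wtX z = (inX z)%:R - (inX (qneg z))%:R.
Proof.
case: z => [[a b] [c d]]; rewrite /wtX /inX /chi /w4 /= !res4N.
by res4_cases4 a b c d.
Qed.
Lemma wtX'_E z : wtX' z = (inX' z)%:R - (inX' (qneg z))%:R.
Proof.
case: z => [[a b] [c d]]; rewrite /wtX' /inX' /chi /w4 /= !res4N.
by res4_cases4 a b c d.
Qed.
Lemma w2333_E z : w2 z.1.1 * w3 z.1.2 * (w3 z.2.1 * w3 z.2.2) = (inX z)%:R + (inX (qneg z))%:R.
Proof.
case: z => [[a b] [c d]]; rewrite /inX /w2 /w3 /= !res4N.
by res4_cases4 a b c d.
Qed.
Lemma w3222_E z : w3 z.1.1 * w2 z.1.2 * (w2 z.2.1 * w2 z.2.2) = (inX' z)%:R + (inX' (qneg z))%:R.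
Proof.
case: z => [[a b] [c d]]; rewrite /inX' /w2 /w3 /= !res4N.
by res4_cases4 a b c d.
Qed.

Lemma polyT_neg z : polyT (qneg z) = - polyT z.
Proof. by case: z => [[a b] [c d]]; rewrite /polyT /=; ring. Qed.
Lemma polyW_neg z : polyW (qneg z) = - polyW z.
Proof. by case: z => [[a b] [c d]]; rewrite /polyW /=; ring. Qed.

Lemma gs_qneg w : gs fib4 (fun z => w (qneg z)) = gs fib4 w.
Proof.
have qnegK : involutive qneg by case=> [[a b] [c d]]; rewrite /qneg /= !opprK.
apply: (gs_reindex _ fib4_fibered qnegK qnegK).
by case=> [[a b] [c d]]; rewrite /nsq4 /nsq2 /nsq /= !abszN.
Qed.

Lemma gs_wtX : gs fib4 (fun z => wtX z * polyT z) =
  2%:R * gs fib4 (fun z => (inX z)%:R * polyT z).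
Proof.
rewrite mulr_natl mulr2n -{2}(gs_qneg (fun z => (inX z)%:R * polyT z)) gsD; apply: eq_gs => z.
by rewrite wtX_E polyT_neg; ring.
Qed.
Lemma gs_wtX' : gs fib4 (fun z => wtX' z * polyW z) =
  2%:R * gs fib4 (fun z => (inX' z)%:R * polyW z).
Proof.
rewrite mulr_natl mulr2n -{2}(gs_qneg (fun z => (inX' z)%:R * polyW z)) gsD; apply: eq_gs => z.
by rewrite wtX'_E polyW_neg; ring.
Qed.

Definition inY z := inX z || inX' z.
(** The parity of the first coordinate tells the two classes apart. The factor 2 makes their theta
    series combine to the square [(th3 ^+ 2 - th2 ^+ 2) ^+ 2] of [cser_theta]. *)
Definition polyY z : int := if odd (res4 z.1.1) then polyT z else 2 * polyW z.

Lemma inY_P z : (inY z)%:R * polyY z = (inX z)%:R * polyT z + 2 * ((inX' z)%:R * polyW z).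
Proof.
by rewrite /inY /polyY /inX /inX'; case: odd => /=; rewrite ?orbF ?mul0r ?mulr0 ?addr0 ?add0r // mulrCA.
Qed.

Lemma cser_gs : 3%:R * cser = gs fib4 (fun z => (inY z)%:R * polyY z).
Proof.
apply: fps_double_inj.
have -> : gs fib4 (fun z => (inY z)%:R * polyY z) =
    gs fib4 (fun z => (inX z)%:R * polyT z) + 2%:R * gs fib4 (fun z => (inX' z)%:R * polyW z).
  by rewrite gsZ gsD; apply: eq_gs => z; apply: inY_P.
rewrite mulrDr -gs_wtX -gs_wtX' gs_polyT gs_polyW.
transitivity (3%:R * (2%:R * cser)); first by ring.
by rewrite cser_theta thA_prod; ring.
Qed.

Lemma coef_cser m : odd m -> 3 * cser m = \sum_(z <- fib4 m | inY z) polyY z.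
Proof.
move=> _; rewrite -[3 * _]/(3%:R * cser m) -coef_fps_natM cser_gs coef_gs [RHS]big_mkcond.
by apply: eq_bigr => z _; case: inY; rewrite ?mul1r ?mul0r.
Qed.

(** * Jacobi's four square theorem *)

Lemma gs_inY : 2%:R * gs fib4 (fun z => (inY z)%:R) = th2 * th3 ^+ 3 + th3 * th2 ^+ 3.
Proof.
have E2 : th2 * th3 ^+ 3 = 2%:R * gs fib4 (fun z => (inX z)%:R).
  transitivity (th2 * th3 * (th3 * th3)); first by ring.
  rewrite th_prod4 mulr_natl mulr2n -{2}(gs_qneg (fun z => (inX z)%:R)) gsD; apply: eq_gs => z.
  exact: w2333_E.
have E3 : th3 * th2 ^+ 3 = 2%:R * gs fib4 (fun z => (inX' z)%:R).
  transitivity (th3 * th2 * (th2 * th2)); first by ring.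
  rewrite th_prod4 mulr_natl mulr2n -{2}(gs_qneg (fun z => (inX' z)%:R)) gsD; apply: eq_gs => z.
  exact: w3222_E.
rewrite E2 E3 -mulrDr gsD; congr (_ * _); apply: eq_gs => z.
by rewrite /inY /inX /inX'; case: odd => /=; rewrite ?orbF ?addr0 ?add0r.
Qed.

(** Jacobi's theorem, checked after the substitution x -> x^4: the left side becomes [L2 - L4],
    known from [E2_L], [L34_rec] and [L4_euler]. *)
Lemma phip_pow4 : (th3 + th2) ^+ 4 = 1 + 8%:R * Sg 1 - 32%:R * dbl (dbl (Sg 1)).
Proof.
apply: dbl_inj; apply: dbl_inj; rewrite !(rmorphXn dbl) /= dbl_dbl_phip th3_4.
have EL : L2 = 1 - 24%:R * dbl (dbl (Sg 1)) - 4%:R * dbl L4 - 3%:R * L4.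
  have -> : L2 = L2 + L3 + 4%:R * L4 - (L3 + L4) - 3%:R * L4 by ring.
  by rewrite E2_L L34_rec; ring.
rewrite EL L4_euler; dblE; ring.
Qed.

Definition par_supp (r : bool) (f : fps) := forall n, odd n != r -> f n = 0.

Lemma par_suppM r s f g : par_supp r f -> par_supp s g -> par_supp (r (+) s) (f * g).
Proof.
move=> Hf Hg n Hn; rewrite coef_fpsM big1 // => i _.
have le_in : (i <= n)%N by rewrite -ltnS.
have [Ei|ne] := eqVneq (odd i) r; last by rewrite Hf ?mul0r.
rewrite Hg ?mulr0 //; apply: contraNneq Hn => Es.
by rewrite -(subnKC le_in) oddD Ei Es.
Qed.

Lemma par_supp_th w (r : bool) : (forall a, odd (res4 a) != r -> w a = 0) -> par_supp r (th w).
Proof.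
move=> Hw n Hn; rewrite coef_gs big_seq big1 // => a; rewrite mem_zfib => /eqP E.
by apply: Hw; rewrite -odd_nsq E.
Qed.

Lemma par_supp_th3 : par_supp false th3.
Proof. by apply: par_supp_th => a; rewrite /w3; case: (res4 a) (res4_lt a) => [|[|[|[|]]]]. Qed.
Lemma par_supp_th2 : par_supp true th2.
Proof. by apply: par_supp_th => a; rewrite /w2; case: (res4 a) (res4_lt a) => [|[|[|[|]]]]. Qed.

(** In odd degree only the terms of [(th3 + th2) ^+ 4] with one or three factors [th2] survive; by
    [gs_inY] they amount to eight times the count. *)
Lemma card_Y m : odd m -> \sum_(z <- fib4 m | inY z) 1 = (sig 1 m)%:Z.
Proof.
move=> odd_m; have m_gt0 : (0 < m)%N by case: m odd_m.
have -> : \sum_(z <- fib4 m | inY z) 1 = gs fib4 (fun z => (inY z)%:R) m.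
  by rewrite coef_gs big_mkcond; apply: eq_bigr => z _; case: inY.
set g := gs _ _; have := congr1 (fun f : fps => f m) phip_pow4.
have -> : (th3 + th2) ^+ 4 = 8%:R * g +
    (th3 * th3 * (th3 * th3) + 6%:R * ((th3 * th2) * (th3 * th2)) + th2 * th2 * (th2 * th2)).
  transitivity (4%:R * (2%:R * g) +
    (th3 * th3 * (th3 * th3) + 6%:R * ((th3 * th2) * (th3 * th2)) + th2 * th2 * (th2 * th2))).
    by rewrite gs_inY; ring.
  by ring.
have H33 := par_suppM par_supp_th3 par_supp_th3; have H22 := par_suppM par_supp_th2 par_supp_th2.
have H32 := par_suppM par_supp_th3 par_supp_th2.
rewrite !(coef_fpsD, coef_fpsN, coef_fps_natM) coef_fps1 (gtn_eqF m_gt0).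
rewrite (par_suppM H33 H33) ?odd_m // (par_suppM H22 H22) ?odd_m // (par_suppM H32 H32) ?odd_m //.
rewrite !coef_dbl dvdn2 odd_m /=; case: m m_gt0 {odd_m} => // m _ /=.
lia.
Qed.

(** * Hecke operators on quaternions *)

Definition qmul (x y : quat) : quat :=
  let: ((a, b), (c, d)) := x in let: ((e, f), (g, h)) := y in
  ((a * e - b * f - c * g - d * h, a * f + b * e + c * h - d * g),
   (a * g + c * e + d * f - b * h, a * h + d * e + b * g - c * f)).

Definition flip1 (y : quat) : quat := ((y.1.1, - y.1.2), y.2).
Definition flip2 (y : quat) : quat := (y.1, (- y.2.1, y.2.2)).
Definition flip3 (y : quat) : quat := (y.1, (y.2.1, - y.2.2)).
Definition cyc (y : quat) : quat := ((y.1.1, y.2.1), (y.2.2, y.1.2)).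

Definition sym2 (s : quat -> quat) (f : quat -> int) (y : quat) : int := f y + f (s y).
Definition sym3 (f : quat -> int) (y : quat) : int := f y + f (cyc y) + f (cyc (cyc y)).
(** The sum over the group of order 24 generated by the sign changes of the coordinates along i, j,
    k and their cyclic permutation. *)
Definition sym24 (f : quat -> int) : quat -> int := sym3 (sym2 flip1 (sym2 flip2 (sym2 flip3 f))).

(** The eigenvector property. The constant 8 is 24 / 3, where 3 is the value of [polyT] at the
    quaternion 1. *)
Lemma sym24_polyT x y : sym24 (fun z => polyT (qmul x z)) y = 8 * polyT x * polyT y.
Proof.
move: x y => [[a b] [c d]] [[e f] [g h]].
rewrite /sym24 /sym3 /sym2 /cyc /flip1 /flip2 /flip3 /qmul /polyT /=.
ring.
Qed.

Lemma sym24_polyW x y : sym24 (fun z => polyW (qmul x z)) y = 8 * polyW x * polyT y.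
Proof.
move: x y => [[a b] [c d]] [[e f] [g h]].
rewrite /sym24 /sym3 /sym2 /cyc /flip1 /flip2 /flip3 /qmul /polyT /polyW /=.
ring.
Qed.

(** * Norm, conjugation and products of residue classes *)

Definition qconj (y : quat) : quat := ((y.1.1, - y.1.2), (- y.2.1, - y.2.2)).
Definition qscale (k : int) (y : quat) : quat := ((k * y.1.1, k * y.1.2), (k * y.2.1, k * y.2.2)).
Definition qadd (x y : quat) : quat :=
  ((x.1.1 + y.1.1, x.1.2 + y.1.2), (x.2.1 + y.2.1, x.2.2 + y.2.2)).
Definition qdot (x y : quat) : int :=
  x.1.1 * y.1.1 + x.1.2 * y.1.2 + x.2.1 * y.2.1 + x.2.2 * y.2.2.

Lemma nsq4E z : (nsq4 z)%:Z = z.1.1 ^+ 2 + z.1.2 ^+ 2 + (z.2.1 ^+ 2 + z.2.2 ^+ 2).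
Proof. by rewrite /nsq4 /nsq2 !PoszD !nsqE. Qed.

Lemma nsq4M x y : nsq4 (qmul x y) = (nsq4 x * nsq4 y)%N.
Proof.
have E : (nsq4 (qmul x y))%:Z = (nsq4 x * nsq4 y)%:Z.
  by rewrite PoszM !nsq4E; case: x y => [[a b] [c d]] [[e f] [g h]] /=; ring.
by case: E.
Qed.

Lemma nsq4Z k z : nsq4 (qscale k z) = (`|k| ^ 2 * nsq4 z)%N.
Proof.
have E : (nsq4 (qscale k z))%:Z = (`|k| ^ 2 * nsq4 z)%:Z.
  by rewrite PoszM -[(`|k| ^ 2)%N]/(nsq k) nsqE !nsq4E; case: z => [[a b] [c d]] /=; ring.
by case: E.
Qed.

Lemma qmul_conj x y : qmul (qmul x y) (qconj y) = qscale (nsq4 y)%:Z x.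
Proof.
rewrite nsq4E; case: x y => [[a b] [c d]] [[e f] [g h]].
by rewrite /qmul /qconj /qscale /=; congr (_, _, (_, _)); ring.
Qed.

Lemma nsq4_conj y : nsq4 (qconj y) = nsq4 y.
Proof. by rewrite /nsq4 /nsq2 /nsq /= !abszN. Qed.

Lemma qconjK : involutive qconj.
Proof. by case=> [[a b] [c d]]; rewrite /qconj /= !opprK. Qed.

Lemma qmul_conj' x y : qmul (qmul x (qconj y)) y = qscale (nsq4 y)%:Z x.
Proof. by rewrite -{2}(qconjK y) qmul_conj nsq4_conj. Qed.

Lemma qscale_inj k : k != 0 -> injective (qscale k).
Proof.
move=> nz_k [[a b] [c d]] [[e f] [g h]] [].
by do 4! [move/(mulfI nz_k) ->].
Qed.

Lemma qmulZl k x y : qmul (qscale k x) y = qscale k (qmul x y).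
Proof.
case: x y => [[a b] [c d]] [[e f] [g h]].
by rewrite /qmul /qscale /=; congr (_, _, (_, _)); ring.
Qed.

Definition inXr (i j k l : nat) : bool :=
  [&& odd i, ~~ odd j, ~~ odd k, ~~ odd l & (i + j + k + l) %% 4 == 1]%N.
Definition inX'r (i j k l : nat) : bool :=
  [&& ~~ odd i, odd j, odd k, odd l & (i + j + k + l) %% 4 == 3]%N.
Definition addr4 (i j : nat) := ((i + j) %% 4)%N.
Definition oppr4 (i : nat) := ((4 - i) %% 4)%N.
Definition mulr4 (i j : nat) := ((i * j) %% 4)%N.
Definition mulr_res (F : nat -> nat -> nat -> nat -> bool) (a b c d e f g h : nat) : bool :=
  F (addr4 (addr4 (addr4 (mulr4 a e) (oppr4 (mulr4 b f))) (oppr4 (mulr4 c g))) (oppr4 (mulr4 d h)))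
    (addr4 (addr4 (addr4 (mulr4 a f) (mulr4 b e)) (mulr4 c h)) (oppr4 (mulr4 d g)))
    (addr4 (addr4 (addr4 (mulr4 a g) (mulr4 c e)) (mulr4 d f)) (oppr4 (mulr4 b h)))
    (addr4 (addr4 (addr4 (mulr4 a h) (mulr4 d e)) (mulr4 b g)) (oppr4 (mulr4 c f))).

Definition all4 (Q : nat -> bool) := [&& Q 0%N, Q 1%N, Q 2%N & Q 3%N].
Lemma all4P Q i : all4 Q -> (i < 4)%N -> Q i.
Proof. by case/and4P; case: i => [|[|[|[|]]]]. Qed.

(** Membership depends only on residues modulo 4, so closure under products is a finite check over
    eight residues, done by computation. *)
Lemma mul_res_check (F : nat -> nat -> nat -> nat -> bool) :
  all4 (fun a => all4 (fun b => all4 (fun c => all4 (fun d => F a b c d ==>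
   all4 (fun e => all4 (fun f => all4 (fun g => all4 (fun h =>
     inXr e f g h ==> mulr_res F a b c d e f g h)))))))) ->
  forall x y, F (res4 x.1.1) (res4 x.1.2) (res4 x.2.1) (res4 x.2.2) -> inX y ->
  F (res4 (qmul x y).1.1) (res4 (qmul x y).1.2) (res4 (qmul x y).2.1) (res4 (qmul x y).2.2).
Proof.
move=> H [[a b] [c d]] [[e f] [g h]] /= Fx Xy.
have := all4P (all4P (all4P (all4P H (res4_lt a)) (res4_lt b)) (res4_lt c)) (res4_lt d).
rewrite Fx /= => {}H.
have := all4P (all4P (all4P (all4P H (res4_lt e)) (res4_lt f)) (res4_lt g)) (res4_lt h).
by rewrite [inXr _ _ _ _]Xy /= !(res4D, res4N, res4M).
Qed.

Lemma inX_mul x y : inX x -> inX y -> inX (qmul x y).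
Proof. by apply: (mul_res_check (F := inXr)); vm_compute. Qed.
Lemma inX'_mul x y : inX' x -> inX y -> inX' (qmul x y).
Proof. by apply: (mul_res_check (F := inX'r)); vm_compute. Qed.

Lemma inX_conj y : inX (qconj y) = inX y.
Proof.
case: y => [[a b] [c d]]; rewrite /inX /qconj /= !res4N.
by res4_cases4 a b c d.
Qed.

Lemma inY_mul x y : inY x -> inX y -> inY (qmul x y).
Proof.
by rewrite /inY => /orP[] Hx Hy; apply/orP; [left; apply: inX_mul | right; apply: inX'_mul].
Qed.

Lemma nsq_mod4 a : (nsq a %% 4 = odd (res4 a))%N.
Proof.
rewrite /nsq -modnXm; have : (`|a| %% 4 = res4 a \/ `|a| %% 4 = (4 - res4 a) %% 4)%N.
  by rewrite /res4; lia.
by move=> [] ->; case: (res4 a) (res4_lt a) => [|[|[|[|]]]].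
Qed.

Lemma nsq4_mod4 z : (nsq4 z %% 4 = (odd (res4 z.1.1) + odd (res4 z.1.2)
  + (odd (res4 z.2.1) + odd (res4 z.2.2))) %% 4)%N.
Proof.
rewrite -!nsq_mod4 /nsq4 /nsq2.
move: (nsq _) (nsq _) (nsq _) (nsq _) => i j k l; lia.
Qed.

Lemma inX'_nsq4 z : inX' z -> (nsq4 z %% 4 = 3)%N.
Proof.
by case/and5P=> /negPf z1 z2 z3 z4 _; rewrite nsq4_mod4 z1 z2 z3 z4.
Qed.

Lemma res4_mod a : (res4 a %% 4 = res4 a)%N.
Proof. by rewrite modn_small ?res4_lt. Qed.

Lemma inY_scale k z : res4 k = 1%N -> inY (qscale k z) = inY z.
Proof.
move=> k1; rewrite /inY /inX /inX' /qscale /= !res4M k1 !mul1n.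
by rewrite !res4_mod.
Qed.

Lemma polyY_scale k z : res4 k = 1%N -> polyY (qscale k z) = k ^+ 7 * polyY z.
Proof.
move=> k1; rewrite /polyY /= res4M k1 mul1n res4_mod.
by case: ifP => _; case: z => [[a b] [c d]]; rewrite /polyT /polyW /=; ring.
Qed.

Lemma odd_qmul x y : inX y -> odd (res4 (qmul x y).1.1) = odd (res4 x.1.1).
Proof.
move=> Xy; apply/eqP; set r := odd (res4 x.1.1).
apply: (mul_res_check (F := fun i _ _ _ => odd i == r)) => //.
by case: r; vm_compute.
Qed.

Lemma inX_flip1 y : inX (flip1 y) = inX y.
Proof. by case: y => [[a b] [c d]]; rewrite /inX /flip1 /= !res4N; res4_cases4 a b c d. Qed.
Lemma inX_flip2 y : inX (flip2 y) = inX y.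
Proof. by case: y => [[a b] [c d]]; rewrite /inX /flip2 /= !res4N; res4_cases4 a b c d. Qed.
Lemma inX_flip3 y : inX (flip3 y) = inX y.
Proof. by case: y => [[a b] [c d]]; rewrite /inX /flip3 /= !res4N; res4_cases4 a b c d. Qed.
Lemma inX_cyc y : inX (cyc y) = inX y.
Proof. by case: y => [[a b] [c d]]; rewrite /inX /cyc /=; res4_cases4 a b c d. Qed.

Lemma sym24_polyY x y : inX y -> sym24 (fun z => polyY (qmul x z)) y = 8 * polyY x * polyT y.
Proof.
move=> Xy; pose G z := if odd (res4 x.1.1) then polyT (qmul x z) else 2 * polyW (qmul x z).
have XE z : inX z -> polyY (qmul x z) = G z by move=> Xz; rewrite /polyY odd_qmul.
have -> : sym24 (fun z => polyY (qmul x z)) y = sym24 G y.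
  by rewrite /sym24 /sym3 /sym2 !XE ?(inX_flip1, inX_flip2, inX_flip3, inX_cyc).
rewrite /G /polyY; case: odd; first exact: sym24_polyT.
have -> : 8 * (2 * polyW x) * polyT y = 2 * (8 * polyW x * polyT y) by ring.
by rewrite -sym24_polyW /sym24 /sym3 /sym2; ring.
Qed.

(** * The Hecke operator on quaternions of given norm *)

Definition Yl (m : nat) : seq quat := [seq z <- fib4 m | inY z].

Lemma Yl_uniq m : uniq (Yl m).
Proof. by rewrite filter_uniq //; case: (fib4_fibered m). Qed.
Lemma mem_Yl m z : (z \in Yl m) = inY z && (nsq4 z == m).
Proof. by rewrite mem_filter; case: (fib4_fibered m) => _ ->. Qed.

Section Hecke.

Variables (p : nat) (p_mod4 : (p %% 4 = 1)%N).

Lemma mem_Yl_p z : z \in Yl p -> inX z.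
Proof.
rewrite mem_Yl => /andP[/orP[] // /inX'_nsq4 E /eqP Ez].
by rewrite Ez p_mod4 in E.
Qed.

Lemma sum_Yl_bij (s : quat -> quat) (f : quat -> int) :
  injective s -> (forall z, inX (s z) = inX z) -> (forall z, nsq4 (s z) = nsq4 z) ->
  \sum_(y <- Yl p) f (s y) = \sum_(y <- Yl p) f y.
Proof.
move=> s_inj sX sN; rewrite -(big_map s xpredT f); apply: perm_big.
have us : uniq (map s (Yl p)) by rewrite map_inj_uniq ?Yl_uniq.
apply: uniq_perm => //; first exact: Yl_uniq.
have sub : {subset map s (Yl p) <= Yl p}.
  move=> _ /mapP[z zY ->]; have zX := mem_Yl_p zY.
  by move: zY; rewrite !mem_Yl sN /inY sX zX.
by have [] := uniq_min_size us sub; rewrite ?size_map.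
Qed.

Lemma sum_sym24 (f : quat -> int) :
  \sum_(y <- Yl p) sym24 f y = 24 * \sum_(y <- Yl p) f y.
Proof.
have s2 s g : injective s -> (forall z, inX (s z) = inX z) -> (forall z, nsq4 (s z) = nsq4 z) ->
    \sum_(y <- Yl p) sym2 s g y = 2 * \sum_(y <- Yl p) g y.
  by move=> si sX sN; rewrite big_split /= (sum_Yl_bij g si) //; ring.
have cyc_inj : injective cyc by move=> [[a b] [c d]] [[e f'] [g h]] [-> -> -> ->].
have cycN z : nsq4 (cyc z) = nsq4 z.
  by rewrite /nsq4 /nsq2 /=; lia.
have s3 g : \sum_(y <- Yl p) sym3 g y = 3 * \sum_(y <- Yl p) g y.
  have c1 := sum_Yl_bij g cyc_inj inX_cyc cycN.
  have /= c2 := sum_Yl_bij (fun y => g (cyc y)) cyc_inj inX_cyc cycN.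
  by rewrite /sym3 !big_split /= c2 c1; ring.
rewrite /sym24 s3.
rewrite !s2 //; first by ring.
- by apply: (can_inj (g := flip3)); case=> [z [c d]]; rewrite /flip3 /= opprK.
- exact: inX_flip3.
- by move=> z; rewrite /nsq4 /nsq2 /nsq /= !abszN.
- by apply: (can_inj (g := flip2)); case=> [z [c d]]; rewrite /flip2 /= opprK.
- exact: inX_flip2.
- by move=> z; rewrite /nsq4 /nsq2 /nsq /= !abszN.
- by apply: (can_inj (g := flip1)); case=> [[a b] z]; rewrite /flip1 /= opprK.
- exact: inX_flip1.
- by move=> z; rewrite /nsq4 /nsq2 /nsq /= !abszN.
Qed.

Lemma polyY_p y : y \in Yl p -> polyY y = polyT y.
Proof. by case/mem_Yl_p/and5P=> y1 _ _ _ _; rewrite /polyY y1. Qed.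

Lemma sum_polyY_mul m :
  3 * \sum_(x <- Yl m) \sum_(y <- Yl p) polyY (qmul x y) =
  (\sum_(x <- Yl m) polyY x) * \sum_(y <- Yl p) polyY y.
Proof.
have H x : 3 * \sum_(y <- Yl p) polyY (qmul x y) = polyY x * \sum_(y <- Yl p) polyY y.
  have E := sum_sym24 (fun z => polyY (qmul x z)).
  have E' : \sum_(y <- Yl p) sym24 (fun z => polyY (qmul x z)) y =
      8 * (polyY x * \sum_(y <- Yl p) polyY y).
    rewrite !mulr_sumr; apply: eq_big_seq => y Yy.
    by rewrite sym24_polyY ?mem_Yl_p // (polyY_p Yy) mulrA.
  by move: E; rewrite E'; lia.
by rewrite mulr_sumr mulr_suml; apply: eq_bigr => x _; apply: H.
Qed.

End Hecke.

Lemma sum_fibers (S T : eqType) (s : seq S) (t : seq T) (h : S -> T) (G : T -> int) :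
  uniq t -> (forall u, u \in s -> h u \in t) ->
  \sum_(u <- s) G (h u) = \sum_(z <- t) (count (fun u => h u == z) s)%:Z * G z.
Proof.
move=> ut hs.
transitivity (\sum_(z <- t) \sum_(u <- s) (h u == z)%:R * G z); last first.
  apply: eq_bigr => z _; rewrite -mulr_suml; congr (_ * _).
  by rewrite -sum1_count -natz natr_sum [RHS]big_mkcond; apply: eq_bigr => u _; case: eqP.
rewrite exchange_big; apply: eq_big_seq => u su /=.
rewrite (bigD1_seq (h u)) ?hs //= eqxx mul1r big1 ?addr0 // => z ne_z.
by rewrite eq_sym (negPf ne_z) mul0r.
Qed.

Definition pdvd (p : nat) (z : quat) : bool :=
  [&& (p %| z.1.1)%Z, (p %| z.1.2)%Z, (p %| z.2.1)%Z & (p %| z.2.2)%Z].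

Lemma pdvdP p z : reflect (exists z', z = qscale p%:Z z') (pdvd p z).
Proof.
apply: (iffP and4P) => [[/dvdzP[a Ea] /dvdzP[b Eb] /dvdzP[c0 Ec] /dvdzP[d Ed]]|[z' ->]].
  exists ((a, b), (c0, d)); case: z Ea Eb Ec Ed => [[a' b'] [c' d']] /= -> -> -> ->.
  by rewrite /qscale /= ![_ * p%:Z]mulrC.
by split; apply: dvdz_mulr.
Qed.

(** Divisors of [p * m] divisible by [p] are [p] times the divisors of [m]; the others are the
    divisors of [m] prime to [p]. The extra term supplies the missing divisors of [m]. *)
Lemma sum_divisors_mulp p m : prime p -> (0 < m)%N ->
  (sig 1 (p * m) + (if p %| m then p * sig 1 (m %/ p) else 0) = p.+1 * sig 1 m)%N.
Proof.
move=> p_pr m_gt0; have p_gt0 := prime_gt0 p_pr; rewrite /sig.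
under [X in (X + _)%N]eq_bigr do rewrite expn1.
under [X in (_ + (if _ then _ * X else _))%N]eq_bigr do rewrite expn1.
under [X in _ = (_ * X)%N]eq_bigr do rewrite expn1.
have pm_gt0 : (0 < p * m)%N by rewrite muln_gt0 p_gt0.
have pdiv n : (0 < n)%N -> (\sum_(d <- divisors (p * n) | p %| d) d = p * \sum_(d <- divisors n) d)%N.
  move=> n_gt0; have pn_gt0 : (0 < p * n)%N by rewrite muln_gt0 p_gt0.
  rewrite big_distrr /= -big_filter -(big_map (muln p) xpredT id); apply: perm_big.
  apply: uniq_perm.
  - by rewrite filter_uniq ?divisors_uniq.
  - by rewrite map_inj_uniq ?divisors_uniq // => i j /eqP; rewrite eqn_pmul2l // => /eqP.
  move=> d; rewrite mem_filter -dvdn_divisors //; apply/andP/mapP => [[/dvdnP[e ->]]|[e]].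
    by rewrite mulnC dvdn_pmul2l // => en; exists e; rewrite -?dvdn_divisors // mulnC.
  by rewrite -dvdn_divisors // => en ->; rewrite dvdn_mulr // dvdn_pmul2l.
have npdiv : (\sum_(d <- divisors (p * m) | ~~ (p %| d)) d = \sum_(d <- divisors m | ~~ (p %| d)) d)%N.
  rewrite -[LHS]big_filter -[RHS]big_filter; apply: perm_big.
  apply: uniq_perm; rewrite ?filter_uniq ?divisors_uniq // => d.
  rewrite !mem_filter -!dvdn_divisors //; case: (boolP (p %| d)%N) => //= npd.
  by rewrite Gauss_dvdr // coprime_sym prime_coprime.
have -> : (if p %| m then p * \sum_(d <- divisors (m %/ p)) d else 0)%N =
    (\sum_(d <- divisors m | p %| d) d)%N.
  case: ifP => [pm|npm].
    have q0 : (0 < m %/ p)%N by rewrite divn_gt0 // dvdn_leq.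
    by rewrite -(pdiv _ q0) mulnC divnK.
  rewrite big_seq_cond big1 // => d; rewrite -dvdn_divisors // => /andP[dm pd].
  by rewrite (dvdn_trans pd dm) in npm.
have Em : (\sum_(d <- divisors m) d =
    \sum_(d <- divisors m | p %| d) d + \sum_(d <- divisors m | ~~ (p %| d)) d)%N.
  exact: bigID.
rewrite (bigID (fun d => p %| d)%N) /= pdiv // npdiv mulSn {2}Em.
by rewrite addnAC -addnA [in RHS]addnC addnC; congr (_ + _)%N; rewrite addnC.
Qed.

Lemma size_Yl m : odd m -> size (Yl m) = sig 1 m.
Proof.
move=> /card_Y; rewrite -[\sum_(_ <- _ | _) _]big_filter -/(Yl m) => E.
by have: (size (Yl m))%:Z = (sig 1 m)%:Z; [rewrite -E -sum1_size -natz natr_sum | case].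
Qed.

Lemma coef_cser_Yl m : odd m -> 3 * cser m = \sum_(z <- Yl m) polyY z.
Proof. by move=> m_odd; rewrite coef_cser // big_filter. Qed.

Lemma inX_qneg z : inX z -> ~~ inX (qneg z).
Proof. by case: z => [[a b] [c0 d]]; rewrite /inX /= !res4N; res4_cases4 a b c0 d. Qed.

(** * Counting factorizations with a right factor of norm p *)

Section HeckeRelation.

Variables (p : nat) (p_prime : prime p) (p_mod4 : (p %% 4 = 1)%N).
Variables (m : nat) (m_odd : odd m).

Let p_gt0 : (0 < p)%N. Proof. exact: prime_gt0. Qed.
Let m_gt0 : (0 < m)%N. Proof. by case: m m_odd. Qed.
Let p_odd : odd p. Proof. by lia. Qed.
Let nz_p : p%:Z != 0. Proof. by lia. Qed.
Let res4_p : res4 p%:Z = 1%N. Proof. by rewrite /res4; lia. Qed.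

Lemma mem_Yl_mul x y : x \in Yl m -> y \in Yl p -> qmul x y \in Yl (p * m).
Proof.
move=> xY yY; have yX := mem_Yl_p p_mod4 yY; move: xY yY.
rewrite !mem_Yl nsq4M => /andP[xY /eqP ->] /andP[_ /eqP ->].
by rewrite inY_mul // mulnC eqxx.
Qed.

Definition facts : seq (quat * quat) := [seq (x, y) | x <- Yl m, y <- Yl p].
Definition nfact (z : quat) : nat := count (fun u => qmul u.1 u.2 == z) facts.

Lemma mem_facts x y : ((x, y) \in facts) = (x \in Yl m) && (y \in Yl p).
Proof. by rewrite /facts; apply/allpairsP/andP => [[[a b] /= [? ? [-> ->]]]|[? ?]]; last exists (x, y). Qed.

Lemma facts_uniq : uniq facts.
Proof. by apply: allpairs_uniq; rewrite ?Yl_uniq // => -[? ?] [? ?] _ _ [-> ->]. Qed.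

Lemma sum_nfact (G : quat -> int) :
  \sum_(x <- Yl m) \sum_(y <- Yl p) G (qmul x y) =
  \sum_(z <- Yl (p * m)) (nfact z)%:Z * G z.
Proof.
rewrite -(sum_fibers (h := fun u => qmul u.1 u.2)) ?Yl_uniq //.
  by rewrite big_allpairs.
by case=> x y; rewrite mem_facts => /andP[xY yY]; apply: mem_Yl_mul.
Qed.

Lemma Yl_dot_odd y y' : inX y -> inX y' -> odd `|qdot y y'|.
Proof.
move=> /and5P[a1 a2 a3 a4 _] /and5P[b1 b2 b3 b4 _].
have oddz (k : int) : odd `|k| = odd (res4 k) by rewrite /res4; lia.
rewrite oddz /qdot.
have oddr4 i : odd (i %% 4) = odd i by lia.
rewrite !(res4D, res4M) !(oddr4, oddD, oddM) a1 b1.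
by rewrite (negPf a2) (negPf a3) (negPf a4).
Qed.

Lemma qscale_eq_mul x y z : y \in Yl p -> qmul x y = z -> qmul z (qconj y) = qscale p%:Z x.
Proof. by rewrite mem_Yl => /andP[_ /eqP <-] <-; apply: qmul_conj. Qed.

Lemma qmulDr z u v : qmul z (qadd u v) = qadd (qmul z u) (qmul z v).
Proof.
case: z u v => [[a b] [c0 d]] [[e f] [g h]] [[i j] [k l]].
by rewrite /qmul /qadd /=; congr (_, _, (_, _)); ring.
Qed.

Lemma qadd_conj u v : qadd (qconj u) (qconj v) = qconj (qadd u v).
Proof. by rewrite /qadd /qconj /= !opprD. Qed.

Lemma qadd_scale k u v : qadd (qscale k u) (qscale k v) = qscale k (qadd u v).
Proof. by rewrite /qadd /qscale /= !mulrDr. Qed.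

Lemma nsq4_add u v : (nsq4 (qadd u v))%:Z = (nsq4 u)%:Z + (nsq4 v)%:Z + 2 * qdot u v.
Proof. by rewrite !nsq4E /qadd /qdot /=; ring. Qed.

Lemma nsq4_sub u v : (nsq4 (qadd u (qscale (-1) v)))%:Z = (nsq4 u)%:Z + (nsq4 v)%:Z - 2 * qdot u v.
Proof. by rewrite !nsq4E /qadd /qdot /qscale /=; ring. Qed.

Lemma nsq4_eq0 z : nsq4 z = 0%N -> z = ((0, 0), (0, 0)).
Proof.
case: z => [[a b] [c0 d]]; rewrite /nsq4 /nsq2 /= => E.
have sq0 (k : int) : nsq k = 0%N -> k = 0.
  by move/eqP; rewrite expn_eq0 andbT absz_eq0 => /eqP.
have {E} : [/\ nsq a = 0, nsq b = 0, nsq c0 = 0 & nsq d = 0]%N.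
  by move: E; move: (nsq a) (nsq b) (nsq c0) (nsq d) => i j k l ?; split; lia.
by case=> /sq0 -> /sq0 -> /sq0 -> /sq0 ->.
Qed.

Lemma pdvd_scale k z : ~~ (p %| `|k|)%N -> pdvd p (qscale k z) -> pdvd p z.
Proof.
move=> npk /and4P[/= Ha Hb Hc Hd]; move: Ha Hb Hc Hd.
rewrite !dvdzE /= !abszM !Euclid_dvdM // (negPf npk) /= => Ha Hb Hc Hd.
by rewrite /pdvd !dvdzE /= Ha Hb Hc Hd.
Qed.

(* Two factorizations with distinct right factors [y], [y'] force [p | z]: [z] times the
   conjugate of [y + y'] is divisible by [p], while the norm [2 p + 2 <y, y'>] of [y + y']
   is prime to [p], as [<y, y'>] is odd and strictly between [-p] and [p]. *)
Lemma nfact_pdvd z x y x' y' : y \in Yl p -> y' \in Yl p ->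
  qmul x y = z -> qmul x' y' = z -> y != y' -> pdvd p z.
Proof.
move=> yY yY' E E' ne_y.
have [yX yX'] := (mem_Yl_p p_mod4 yY, mem_Yl_p p_mod4 yY').
have [Ny Ny'] : nsq4 y = p /\ nsq4 y' = p.
  by move: yY yY'; rewrite !mem_Yl => /andP[_ /eqP ->] /andP[_ /eqP ->].
have dot_odd := Yl_dot_odd yX yX'.
have Npos := nsq4_add y y'; have Nneg := nsq4_sub y y'; rewrite Ny Ny' in Npos Nneg.
have nz_neg : nsq4 (qadd y (qscale (-1) y')) != 0%N.
  apply: contra ne_y => /eqP/nsq4_eq0; clear; case: y y' => [[a b] [c0 d]] [[e f] [g h]].
  by rewrite /qadd /qscale /= => -[] Ea Eb Ec Ed; apply/eqP; congr (_, _, (_, _)); lia.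
(* [y' = - y] is excluded because the class [inX] never contains both. Positive norms of [y + y']
   and [y - y'] then bound the inner product strictly by [p]. *)
have nz_pos : nsq4 (qadd y y') != 0%N.
  apply/eqP => /nsq4_eq0 E0; have := inX_qneg yX.
  have -> : qneg y = y'; last by rewrite yX'.
  move: E0; clear; case: y y' => [[a b] [c0 d]] [[e f] [g h]].
  by rewrite /qadd /qneg /= => -[] Ea Eb Ec Ed; congr (_, _, (_, _)); lia.
have npN : ~~ (p %| nsq4 (qadd y y'))%N.
  apply/negP => pN.
  have : (p%:Z %| 2 * qdot y y')%Z.
    have -> : 2 * qdot y y' = (nsq4 (qadd y y'))%:Z - 2 * p%:Z by rewrite Npos; lia.
    by rewrite rpredB // dvdz_mull.
  rewrite dvdzE abszM Euclid_dvdM // => /orP[/dvdn_leq|]; first by move/(_ isT); lia.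
  move=> /dvdnP[k Ek]; have : (`|qdot y y'| < p)%N by lia.
  by rewrite Ek; case: k Ek => [|k] Ek; [rewrite Ek in dot_odd | rewrite mulSn; lia].
apply: (@pdvd_scale (nsq4 (qadd y y'))%:Z) => //.
rewrite -qmul_conj' -qadd_conj (qmulDr z (qconj y)) (qscale_eq_mul yY E) (qscale_eq_mul yY' E').
by rewrite qadd_scale qmulZl; apply/pdvdP; eexists.
Qed.

Lemma nfact_le1 z : ~~ pdvd p z -> (nfact z <= 1)%N.
Proof.
move=> npz; rewrite /nfact -size_filter; set t := filter _ _.
have ut : uniq t by rewrite filter_uniq ?facts_uniq.
have t_eq u v : u \in t -> v \in t -> u = v.
  case: u v => [x y] [x' y']; rewrite !mem_filter !mem_facts /=.
  move=> /andP[/eqP E /andP[_ yY]] /andP[/eqP E' /andP[_ yY']].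
  have [Ey|ne_y] := eqVneq y y'; last by rewrite (nfact_pdvd yY yY' E E' ne_y) in npz.
  rewrite Ey in E yY *; congr (_, _); apply: (qscale_inj nz_p).
  by rewrite -(qscale_eq_mul yY E) -(qscale_eq_mul yY E').
case: t ut t_eq => [|u [|v t]] //= /andP[/norP[/eqP ne_uv _] _] t_eq.
by case: ne_uv; apply: t_eq; rewrite !inE eqxx ?orbT.
Qed.

(** If z = p z', every y of norm p gives the factorization z = (z' conj(y)) y, and y determines the
    left factor. *)
Lemma nfact_dvd z : z \in Yl (p * m) -> pdvd p z -> nfact z = size (Yl p).
Proof.
move=> zY /pdvdP[z' Ez]; rewrite /nfact -size_filter.
pose h y := (qmul z' (qconj y), y).
rewrite -(size_map h); apply: perm_size; apply: uniq_perm.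
- by rewrite filter_uniq ?facts_uniq.
- by rewrite map_inj_uniq ?Yl_uniq // => y y' [].
have Ny y : y \in Yl p -> nsq4 y = p by rewrite mem_Yl => /andP[_ /eqP].
case=> x y; rewrite mem_filter mem_facts /=; apply/andP/mapP => [[/eqP E /andP[_ yY]]|[y' yY']].
  exists y => //; congr (_, _); apply: (qscale_inj nz_p).
  by rewrite -(qscale_eq_mul yY E) Ez qmulZl.
case=> -> ->; rewrite yY' andbT qmul_conj' (Ny _ yY') Ez; split=> //.
move: zY; rewrite Ez !mem_Yl inY_scale // nsq4Z nsq4M nsq4_conj (Ny _ yY') => /andP[zY' /eqP E].
rewrite inY_mul ?inX_conj ?(mem_Yl_p p_mod4 yY') //=; apply/eqP/eqP.
by rewrite -(eqn_pmul2l p_gt0) -E mulnA mulnC mulnA.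
Qed.

Lemma sum_pdvd (f : quat -> int) :
  \sum_(z <- Yl (p * m) | pdvd p z) f z =
  if (p %| m)%N then \sum_(z <- Yl (m %/ p)) f (qscale p%:Z z) else 0.
Proof.
have mem z : qscale p%:Z z \in Yl (p * m) = inY z && (p * nsq4 z == m)%N.
  by rewrite mem_Yl inY_scale // nsq4Z /= -mulnn -mulnA eqn_pmul2l.
case: ifP => [pm|npm]; last first.
  rewrite big_seq_cond big1 // => z /andP[zY /pdvdP[z' Ez]].
  by move: zY; rewrite Ez mem => /andP[_ /eqP Em]; rewrite -Em dvdn_mulr in npm.
rewrite -big_filter -(big_map (qscale p%:Z) xpredT f); apply: perm_big; apply: uniq_perm.
- by rewrite filter_uniq ?Yl_uniq.
- by rewrite map_inj_uniq ?Yl_uniq //; apply: qscale_inj nz_p.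
move=> z; rewrite mem_filter; apply/andP/mapP => [[/pdvdP[z' ->]]|[z' zY' ->]].
  rewrite mem => /andP[zY' /eqP Em]; exists z' => //.
  by rewrite mem_Yl zY' -Em mulKn ?eqxx.
split; first by apply/pdvdP; exists z'.
by move: zY'; rewrite mem mem_Yl => /andP[-> /eqP ->]; rewrite mulnC divnK ?eqxx.
Qed.

Lemma size_Yl_p : size (Yl p) = p.+1.
Proof.
by have := sum_divisors_mulp p_prime (ltn0Sn 0); rewrite muln1 dvdn1 gtn_eqF ?prime_gt1 // addn0
  size_Yl // => ->; rewrite /sig big_cons big_nil muln1.
Qed.

(** Of the (p + 1) sigma(m) pairs, (p + 1) sigma(m / p) have a product divisible by p. By
    [sum_divisors_mulp] the rest number sigma(p m) - sigma(m / p), which also counts the elements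
    not divisible by p. *)
Lemma sum_nfact_ndvd :
  \sum_(z <- Yl (p * m) | ~~ pdvd p z) (nfact z)%:Z = \sum_(z <- Yl (p * m) | ~~ pdvd p z) 1.
Proof.
have all1 k : odd k -> \sum_(z <- Yl k) 1 = (sig 1 k)%:Z.
  by move=> k_odd; rewrite -size_Yl // -sum1_size -natz natr_sum.
have odd_pm : odd (p * m) by rewrite oddM p_odd.
have m_div_odd : (p %| m)%N -> odd (m %/ p).
  by move=> pm; move: m_odd; rewrite -{1}(divnK pm) oddM => /andP[].
pose D : int := if (p %| m)%N then (sig 1 (m %/ p))%:Z else 0.
have ED : \sum_(z <- Yl (p * m) | pdvd p z) 1 = D.
  by rewrite (sum_pdvd (fun => 1)) /D; case: ifP => // pm; rewrite all1 ?m_div_odd.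
have EN : \sum_(z <- Yl (p * m) | pdvd p z) (nfact z)%:Z = p.+1%:Z * D.
  rewrite -ED mulr_sumr big_seq_cond [RHS]big_seq_cond; apply: eq_bigr => z /andP[zY pz].
  by rewrite nfact_dvd // size_Yl_p mulr1.
have Etot : p.+1%:Z * (sig 1 m)%:Z = \sum_(z <- Yl (p * m)) (nfact z)%:Z.
  rewrite -all1 // mulr_sumr -size_Yl_p.
  have := sum_nfact (fun => 1); under [RHS]eq_bigr do rewrite mulr1.
  by move=> <-; apply: eq_bigr => x _; rewrite mulr1 -sum1_size -natz natr_sum.
have Esig : (sig 1 (p * m))%:Z + p%:Z * D = p.+1%:Z * (sig 1 m)%:Z.
  rewrite -PoszM -(sum_divisors_mulp p_prime m_gt0) PoszD /D.
  by case: ifP => _; rewrite ?mulr0.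
rewrite (bigID (pdvd p)) EN /= in Etot.
have := all1 _ odd_pm; rewrite (bigID (pdvd p)) ED /= => Epm.
move: Etot Esig; rewrite -Epm (_ : p.+1%:Z = p%:Z + 1); last by lia.
by move=> -> E; lra.
Qed.

(** Each count is at most one and the counts sum to the number of elements, so none can be zero. *)
Lemma nfact_ndvd z : z \in Yl (p * m) -> ~~ pdvd p z -> nfact z = 1%N.
Proof.
move=> zY npz; apply/eqP; rewrite eqn_leq nfact_le1 // lt0n; apply/negP => /eqP nz.
have := sum_nfact_ndvd; rewrite -[LHS]big_filter -[RHS]big_filter.
set t := [seq _ <- _ | _].
have zt : z \in t by rewrite mem_filter npz.
have ut : uniq t by rewrite filter_uniq ?Yl_uniq.
rewrite [LHS](bigD1_seq z zt ut) [RHS](bigD1_seq z zt ut) /= nz add0r.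
have le : \sum_(i <- t | i != z) (nfact i)%:Z <= \sum_(i <- t | i != z) (1 : int).
  rewrite big_seq_cond [leRHS]big_seq_cond; apply: ler_sum => i /andP[].
  by rewrite mem_filter => /andP[npi _] _; rewrite lez_nat nfact_le1.
by move=> E; move: le; rewrite E gerDr.
Qed.

Lemma hecke_relation :
  cser (p * m)%N + (if (p %| m)%N then p%:Z ^+ 8 * cser (m %/ p)%N else 0) = cser p * cser m.
Proof.
have odd_pm : odd (p * m) by rewrite oddM p_odd.
(* A factor 3 for each of the two coefficients on the right, since [3 * cser] is what the quaternion
   sums give. *)
apply: (@mulfI _ 9) => //.
have -> : 9 * (cser p * cser m) = (3 * cser m) * (3 * cser p) by ring.
rewrite !coef_cser_Yl // -(sum_polyY_mul p_mod4) (sum_nfact polyY).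
(* Multiples of [p] have [p + 1] factorizations, all other elements exactly one. *)
have -> : \sum_(z <- Yl (p * m)) (nfact z)%:Z * polyY z =
    \sum_(z <- Yl (p * m)) polyY z + p%:Z * \sum_(z <- Yl (p * m) | pdvd p z) polyY z.
  rewrite (bigID (pdvd p)) [X in _ = X + _](bigID (pdvd p)) /= addrAC; congr (_ + _).
    rewrite mulr_sumr -big_split big_seq_cond [RHS]big_seq_cond; apply: eq_bigr => z /andP[zY pz].
    by rewrite nfact_dvd // size_Yl_p /= (_ : p.+1%:Z = p%:Z + 1); [ring|lia].
  rewrite big_seq_cond [RHS]big_seq_cond; apply: eq_bigr => z /andP[zY npz].
  by rewrite nfact_ndvd // mul1r.
rewrite -coef_cser_Yl // sum_pdvd.
case: ifP => [pm|_]; last by ring.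
(* Homogeneity of degree 7 gives p^7; the surplus of p factorizations raises it to p^8. *)
under eq_bigr do rewrite polyY_scale //.
rewrite -mulr_sumr -coef_cser_Yl; first by ring.
by move: m_odd; rewrite -{1}(divnK pm) oddM => /andP[].
Qed.

End HeckeRelation.

(** * Translation back to c(n) *)

Lemma coef_cser_odd n : cser n.*2.+1 = c_nat n.
Proof.
by rewrite /cser -[fpsX]expr1 coef_fpsXnM ltnS ltn0 subn1 coef_dbl2.
Qed.

Theorem theorem1p2 (p : nat) (p_prime : prime p) (p_mod4 : p = 1 %[mod 4]) :
  exists y : int, forall n : nat,
    c (p%:R * n%:R + (p%:R - 1) / 2%:R)
      + p%:Z ^+ 8 * c ((n%:R - (p%:R - 1) / 2%:R) / p%:R)
    = y * c n%:R.
Proof.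
(* The eigenvalue is the coefficient of F at p, that is c((p - 1) / 2). *)
exists (cser p) => n.
have [k Ek] : exists k, p = k.*2.+1 by exists p./2; lia.
have Eh : (p%:R - 1) / 2%:R = k%:R :> rat.
  by rewrite Ek -addn1 natrD addrK -muln2 natrM mulfK.
have nz_p : p%:R != 0 :> rat by rewrite pnatr_eq0 Ek.
have n_odd : odd n.*2.+1 by rewrite /= odd_double.
have := hecke_relation p_prime p_mod4 n_odd.
have -> : (p * n.*2.+1 = (p * n + k).*2.+1)%N by rewrite {1}Ek {1}Ek; lia.
rewrite !coef_cser_odd Eh -natrM -natrD !c_natE => <-; congr (_ + _).
case: ifP => [/dvdnP[j Ej]|npn].
  (* As 2 n + 1 is odd, so is its quotient by p; writing it as 2 i + 1 gives (n - k) / p = i. *)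
  have [i Ei] : exists i, j = i.*2.+1.
    by exists j./2; move: n_odd; rewrite Ej oddM => /andP[]; lia.
  have En : (n = i * p + k)%N by move: Ej; rewrite Ei Ek; lia.
  rewrite Ej mulnK ?Ek // -Ek; congr (_ * _).
  by rewrite {1}En natrD addrK natrM mulfK // c_natE Ei coef_cser_odd.
(* Conversely, if (n - k) / p were a natural number i, then p would divide 2 n + 1 = p (2 i + 1). *)
rewrite /c; case: ifP => [/natrP[i Ei]|_]; last by rewrite mulr0.
have En : (n = i * p + k)%N.
  have : n%:R - k%:R = (i * p)%:R :> rat by rewrite natrM -Ei divfK.
  by move/eqP; rewrite subr_eq -natrD eqr_nat => /eqP.
suff : (p %| n.*2.+1)%N by rewrite npn.
have -> : (n.*2.+1 = p * i.*2.+1)%N by rewrite En {2}Ek; lia.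
exact: dvdn_mulr.
Qed.
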